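(* There is a $4$-factor approximation algorithm for the Single Multiple Full Cover (SMFC) problem.
   Context: SMFC problem. The input is a range of timeslots $[1,T]$ with an integral demand $d_t$ at each timeslot $t$, and a set of resources. Each resource $i$ has an interval $[s(i),e(i)]\subseteq[1,T]$, a capacity $w(i)$ and a cost $c(i)$, and is of one of two types: S-type or M-type. A resource is active at $t$ if $t$ lies in its interval. A valid solution is a multiset of resources containing at most one copy of each S-type resource (arbitrarily many copies of M-type resources are allowed). A feasible solution is a valid solution $S$ such that for every timeslot $t$, the total capacity (with multiplicity) of the resources of $S$ active at $t$ is at least $d_t$. The cost is the sum of costs with multiplicity; the goal is to find a feasible solution of minimum cost. An approximation algorithm runs in polynomial time and outputs a feasible solution of cost at most the stated factor times the optimum. *)

(* Defs.v *)
From HB Require Import structures.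
From mathcomp Require Import all_boot all_order all_algebra.

Set Implicit Arguments.
Unset Strict Implicit.
Unset Printing Implicit Defensive.

Import Order.TTheory GRing.Theory Num.Theory.

Local Open Scope ring_scope.

Variant rtype := Stype | Mtype.

Record resource := Resource {
  start : nat;
  finish : nat;
  capacity : rat;
  rcost : rat;
  kind : rtype }.

(* The demand of timeslot t, for 1 <= t <= T, is the entry of rank t - 1 of
   [demands], and T is the length of that list. *)
Record instance := Instance {
  demands : seq nat;
  resources : seq resource }.

Definition horizon (I : instance) : nat := size (demands I).

Definition demand (I : instance) (t : nat) : nat := nth 0%N (demands I) t.-1.

Definition wf_resource (T : nat) (r : resource) : bool :=
  [&& (1 <= start r)%N, (start r <= finish r)%N, (finish r <= T)%N,
      0 <= capacity r & 0 <= rcost r].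

Definition wf_instance (I : instance) : bool :=
  all (wf_resource (horizon I)) (resources I).

Definition active (r : resource) (t : nat) : bool :=
  (start r <= t <= finish r)%N.

(* A multiset of resources is given by the list of the multiplicities of
   the successive entries of [resources I]. *)
Definition multiset := seq nat.

Definition valid (I : instance) (S : multiset) : Prop :=
  size S = size (resources I) /\
  all (fun x : resource * nat => if kind x.1 is Stype then (x.2 <= 1)%N else true)
      (zip (resources I) S).

Definition capacity_at (I : instance) (S : multiset) (t : nat) : rat :=
  \sum_(x <- zip (resources I) S | active x.1 t) x.2%:R * capacity x.1.

Definition feasible (I : instance) (S : multiset) : Prop :=
  valid I S /\
  forall t : nat, (1 <= t <= horizon I)%N -> (demand I t)%:R <= capacity_at I S t.

Definition cost (I : instance) (S : multiset) : rat :=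
  \sum_(x <- zip (resources I) S) x.2%:R * rcost x.1.

(* Programs are while programs acting on binary trees whose leaves are natural
   numbers written in binary.  There are no variables: a program maps one
   tree to one tree, and [Fork] keeps several values in the current tree. *)

Inductive val := Nat of nat | Pair of val & val.

Definition vfst (v : val) : val := if v is Pair a _ then a else Nat 0.
Definition vsnd (v : val) : val := if v is Pair _ b then b else Nat 0.
Definition vnat (v : val) : nat := if v is Nat n then n else 0%N.
Definition is_pair (v : val) : bool := if v is Pair _ _ then true else false.
Definition truth (v : val) : bool := if v is Nat 0 then false else true.

(* The length of the binary writing of n. *)
Definition nbits (n : nat) : nat := (trunc_log 2 n).+1.

Fixpoint vsize (v : val) : nat :=
  match v with
  | Nat n => nbits n
  | Pair a b => (vsize a + vsize b).+1
  end.

Variant arith := OpAdd | OpSub | OpMul | OpDiv.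

Definition arith_eval (o : arith) (m n : nat) : nat :=
  match o with
  | OpAdd => m + n
  | OpSub => m - n
  | OpMul => m * n
  | OpDiv => m %/ n
  end%N.

Inductive prog :=
  | Id
  | Const of nat
  | Fst
  | Snd
  | IsPair
  | Arith of arith
  | Fork of prog & prog
  | Seq of prog & prog
  | If of prog & prog & prog
  | While of prog & prog.

(* [exec p x y t]: on input x, p halts with output y in time t.  Arithmetic is
   charged at logarithmic cost.  The other primitives only copy pointers to
   shared subtrees, whence their unit cost; a run of time t can thus be simulated
   by a Turing machine in time polynomial in t and the size of the input. *)
Inductive exec : prog -> val -> val -> nat -> Prop :=
  | exec_Id x : exec Id x x 1
  | exec_Const n x : exec (Const n) x (Nat n) (nbits n)
  | exec_Fst x : exec Fst x (vfst x) 1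
  | exec_Snd x : exec Snd x (vsnd x) 1
  | exec_IsPair x : exec IsPair x (Nat (is_pair x)) 1
  | exec_Arith o x :
      let m := vnat (vfst x) in let n := vnat (vsnd x) in
      exec (Arith o) x (Nat (arith_eval o m n)) (nbits m + nbits n)
  | exec_Fork p q x y z t u :
      exec p x y t -> exec q x z u -> exec (Fork p q) x (Pair y z) (t + u).+1
  | exec_Seq p q x y z t u :
      exec p x y t -> exec q y z u -> exec (Seq p q) x z (t + u).+1
  | exec_If_true b p q x c y t u :
      exec b x c t -> truth c -> exec p x y u -> exec (If b p q) x y (t + u).+1
  | exec_If_false b p q x c y t u :
      exec b x c t -> ~~ truth c -> exec q x y u -> exec (If b p q) x y (t + u).+1
  | exec_While_stop b p x c t :
      exec b x c t -> ~~ truth c -> exec (While b p) x x t.+1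
  | exec_While_step b p x c y z t u v :
      exec b x c t -> truth c -> exec p x y u -> exec (While b p) y z v ->
      exec (While b p) x z (t + u + v).+1.

Fixpoint encode_list (s : seq val) : val :=
  if s is x :: s' then Pair x (encode_list s') else Nat 0.

(* Only used for nonnegative rationals. *)
Definition encode_rat (q : rat) : val :=
  Pair (Nat `|numq q|%N) (Nat `|denq q|%N).

Definition encode_resource (r : resource) : val :=
  encode_list
    [:: Nat (start r); Nat (finish r); encode_rat (capacity r);
        encode_rat (rcost r); Nat (if kind r is Mtype then 1 else 0)].

Definition encode_instance (I : instance) : val :=
  Pair (encode_list [seq Nat d | d <- demands I])
       (encode_list [seq encode_resource r | r <- resources I]).

Definition encode_multiset (S : multiset) : val :=
  encode_list [seq Nat m | m <- S].

(* The comparison is with every feasible solution, hence with the optimum.  An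
   instance without any feasible solution only requires termination in
   polynomial time. *)
Definition approximation_algorithm (alpha : rat) (A : prog) : Prop :=
  exists a k : nat, forall I : instance, wf_instance I ->
    exists (out : val) (t : nat),
      [/\ exec A (encode_instance I) out t,
          (t <= a * vsize (encode_instance I) ^ k + a)%N
        & (exists S : multiset, feasible I S) ->
          exists S : multiset,
            [/\ out = encode_multiset S, feasible I S
              & forall S' : multiset, feasible I S' ->
                  cost I S <= alpha * cost I S']].

(* Main.v *)
(* A local ratio argument.  Let tau be a slot of maximal residual demand D > 0, and
   charge every resource active at tau, per copy, an amount proportional to
   min(capacity, D), with the factor that makes the residual cost of one of them
   vanish.  A feasible solution pays at least D times the factor.  Select this
   resource (enough copies to cover D if it is of M-type), continue with the residual
   costs and demands, and when everything is covered go through the selected resources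
   in reverse order, keeping of each only the copies that are still needed.  Each
   remaining resource then has a slot at which it cannot lose a copy; those with such a
   slot left of tau all meet at the rightmost one, so they pay at most 2D times the
   factor, and likewise on the right: 4 in total.

   Rationals are avoided by clearing denominators, and the residual costs are rescaled
   in each round instead of being divided, which adds only polynomially many bits. *)

Require Import Defs.
From mathcomp Require Import all_boot all_order all_algebra.
From mathcomp Require Import zify.

Set Implicit Arguments.
Unset Strict Implicit.
Unset Printing Implicit Defensive.

Import Order.TTheory GRing.Theory Num.Theory.

Local Notation tree := Defs.val.

(** * Polynomial bounds *)

(* The base is at least 2, so that constants and sums are absorbed by the
   exponent. *)
Definition polybound (A : Type) (s f : A -> nat) : Prop :=
  exists c, forall a, f a <= (s a + 2) ^ c.

Lemma polybound_refl (A : Type) (s : A -> nat) : polybound s s.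
Proof. by exists 1 => a; rewrite expn1 leq_addr. Qed.

Lemma polybound_const (A : Type) (s : A -> nat) k : polybound s (fun=> k).
Proof.
exists k => a; apply: leq_trans (ltnW (ltn_expl k (ltnSn 1))) _.
by case: k => // k; rewrite leq_exp2r // leq_addl.
Qed.

Lemma polybound_mono (A : Type) (s f g : A -> nat) :
  polybound s g -> (forall a, f a <= g a) -> polybound s f.
Proof. by case=> c Hc le; exists c => a; apply: leq_trans (Hc a). Qed.

Lemma polybound_mul (A : Type) (s f g : A -> nat) :
  polybound s f -> polybound s g -> polybound s (fun a => f a * g a).
Proof.
case=> c Hc [d Hd]; exists (c + d) => a.
by rewrite expnD leq_mul.
Qed.

Lemma polybound_add (A : Type) (s f g : A -> nat) :
  polybound s f -> polybound s g -> polybound s (fun a => f a + g a).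
Proof.
case=> c Hc [d Hd]; exists (c + d).+1 => a.
have le2 : 2 <= s a + 2 by rewrite leq_addl.
have pc : 0 < (s a + 2) ^ c by rewrite expn_gt0 (leq_trans _ le2).
have pd : 0 < (s a + 2) ^ d by rewrite expn_gt0 (leq_trans _ le2).
apply: leq_trans (leq_add (Hc a) (Hd a)) _.
rewrite expnS expnD; apply: (@leq_trans (2 * ((s a + 2) ^ c * (s a + 2) ^ d))).
  by nia.
by rewrite leq_mul2r le2 orbT.
Qed.

Lemma polybound_trans (A : Type) (s f g : A -> nat) :
  polybound s f -> polybound f g -> polybound s g.
Proof.
move=> [c Hc] [d Hd]; exists ((c + 2) * d) => a.
apply: leq_trans (Hd a) _; rewrite expnM.
case: d {Hd} => // d; rewrite leq_exp2r //.
apply: leq_trans (leq_add (Hc a) (leqnn 2)) _.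
have le2 : 2 <= s a + 2 by rewrite leq_addl.
have pc : 0 < (s a + 2) ^ c by rewrite expn_gt0 (leq_trans _ le2).
by rewrite expnD expnS expn1; nia.
Qed.

Lemma polybound_comp (A A' : Type) (h : A -> A') (s f : A' -> nat) :
  polybound s f -> polybound (s \o h) (f \o h).
Proof. by case=> c Hc; exists c => a; apply: Hc. Qed.

(** * Binary length *)

Lemma ltn_nbits n : n < 2 ^ nbits n.
Proof. exact: trunc_log_ltn. Qed.

Lemma nbits_leq n k : 0 < k -> n < 2 ^ k -> nbits n <= k.
Proof.
move=> k0 lt; rewrite /nbits; case: (posnP n) => [->|n0]; first by rewrite trunc_log0.
by rewrite -(ltn_exp2l _ _ (ltnSn 1)); apply: leq_ltn_trans (trunc_logP _ n0) lt.
Qed.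

Lemma leq_nbits m n : m <= n -> nbits m <= nbits n.
Proof. by move=> le; apply/nbits_leq/(leq_ltn_trans le)/ltn_nbits. Qed.

Lemma nbits_add m n : nbits (m + n) <= nbits m + nbits n.
Proof.
apply: nbits_leq; first by [].
have := ltn_nbits m; have := ltn_nbits n; rewrite expnD.
have := expn_gt0 2 (nbits m); have := expn_gt0 2 (nbits n) => /=.
have e k : 2 <= 2 ^ nbits k by rewrite -{1}(expn1 2) leq_exp2l.
by have := e m; have := e n; nia.
Qed.

Lemma nbits_mul m n : nbits (m * n) <= nbits m + nbits n.
Proof.
apply: nbits_leq; first by [].
by have := ltn_nbits m; have := ltn_nbits n; rewrite expnD; nia.
Qed.

Lemma nbits_arith o m n : nbits (arith_eval o m n) <= nbits m + nbits n.
Proof.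
case: o => /=; [exact: nbits_add| |exact: nbits_mul|].
- by apply: leq_trans (leq_nbits (leq_subr _ _)) (leq_addr _ _).
- by apply: leq_trans (leq_nbits (leq_div _ _)) (leq_addr _ _).
Qed.

Lemma nbits_bool (b : bool) : nbits b = 1.
Proof. by case: b. Qed.

Lemma vsize_gt0 v : 0 < vsize v.
Proof. by case: v. Qed.

(** * Functions computable in polynomial time *)

(* Input and output are given as two encodings of one index type [A]: this
   restricts programs to well-formed inputs, and makes [e] the typing context
   of the expression [g]. *)
Definition ptime (A : Type) (e g : A -> tree) : Prop :=
  exists p (tau : A -> nat),
    [/\ forall a, exists2 t, t <= tau a & exec p (e a) (g a) t,
        polybound (vsize \o e) tau & polybound (vsize \o e) (vsize \o g)].

Lemma ptime_eq (A : Type) (e g g' : A -> tree) :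
  g =1 g' -> ptime e g -> ptime e g'.
Proof.
move=> E [p [tau [H1 H2 [c H3]]]]; exists p, tau; split=> //.
  by move=> a; rewrite -E.
by exists c => a /=; rewrite -E; apply: H3.
Qed.

Lemma ptime_id (A : Type) (e : A -> tree) : ptime e e.
Proof.
exists Id, (fun=> 1); split; last exact: polybound_refl.
  by move=> a; exists 1 => //; constructor.
exact: polybound_const.
Qed.

Lemma ptime_seq (A : Type) (e f g : A -> tree) :
  ptime e f -> ptime f g -> ptime e g.
Proof.
move=> [p [t [H1 H2 H3]]] [q [u [K1 K2 K3]]].
exists (Seq p q), (fun a => t a + u a + 1); split.
- move=> a; have [t' le ex] := H1 a; have [u' le' ex'] := K1 a.
  exists (t' + u').+1; last exact: exec_Seq ex ex'.
  by rewrite addn1 ltnS leq_add.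
- apply: polybound_add _ (polybound_const _ 1).
  by apply: polybound_add (polybound_trans H3 K2).
- exact: polybound_trans H3 K3.
Qed.

Lemma ptime_reindex (A A' : Type) (h : A -> A') (e g : A' -> tree) :
  ptime e g -> ptime (e \o h) (g \o h).
Proof.
move=> [p [t [H1 H2 H3]]]; exists p, (t \o h); split.
- by move=> a; apply: H1.
- exact: (polybound_comp h) H2.
- exact: (polybound_comp h) H3.
Qed.

Lemma ptime_comp (A A' : Type) (h : A -> A') (e : A -> tree) (e' g : A' -> tree) :
  ptime e (e' \o h) -> ptime e' g -> ptime e (g \o h).
Proof. by move=> H /(ptime_reindex h); apply: ptime_seq. Qed.

Lemma ptime_pair (A : Type) (e f g : A -> tree) :
  ptime e f -> ptime e g -> ptime e (fun a => Pair (f a) (g a)).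
Proof.
move=> [p [t [H1 H2 H3]]] [q [u [K1 K2 K3]]].
exists (Fork p q), (fun a => t a + u a + 1); split.
- move=> a; have [t' le ex] := H1 a; have [u' le' ex'] := K1 a.
  exists (t' + u').+1; last exact: exec_Fork ex ex'.
  by rewrite addn1 ltnS leq_add.
- exact: polybound_add (polybound_add H2 K2) (polybound_const _ 1).
- apply: polybound_mono (polybound_add (polybound_add H3 K3) (polybound_const _ 1)) _.
  by move=> a /=; rewrite addn1.
Qed.

Lemma ptime_vfst (A : Type) (e : A -> tree) : ptime e (vfst \o e).
Proof.
exists Fst, (fun=> 1); split.
- by move=> a; exists 1 => //; constructor.
- exact: polybound_const.
- apply: polybound_mono (polybound_refl _) _ => a /=.
  by case: (e a) => [n|u v] //=; lia.
Qed.

Lemma ptime_vsnd (A : Type) (e : A -> tree) : ptime e (vsnd \o e).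
Proof.
exists Snd, (fun=> 1); split.
- by move=> a; exists 1 => //; constructor.
- exact: polybound_const.
- apply: polybound_mono (polybound_refl _) _ => a /=.
  by case: (e a) => [n|u v] //=; lia.
Qed.

Lemma ptime_left (A : Type) (e f g : A -> tree) :
  ptime e (fun a => Pair (f a) (g a)) -> ptime e f.
Proof. by move=> H; apply: ptime_seq H (ptime_vfst _). Qed.

Lemma ptime_right (A : Type) (e f g : A -> tree) :
  ptime e (fun a => Pair (f a) (g a)) -> ptime e g.
Proof. by move=> H; apply: ptime_seq H (ptime_vsnd _). Qed.

Definition ctx (A B : Type) (e : A -> tree) (c : B -> tree) (z : A * B) : tree :=
  Pair (e z.1) (c z.2).

Lemma ptime_weak (A B : Type) (e : A -> tree) (c : B -> tree) (g : A -> tree) :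
  ptime e g -> ptime (ctx e c) (fun z => g z.1).
Proof. exact/ptime_comp/ptime_left/ptime_id. Qed.

Lemma ptime_var (A B : Type) (e : A -> tree) (c : B -> tree) :
  ptime (ctx e c) (fun z => c z.2).
Proof. exact/ptime_right/ptime_id. Qed.

Lemma ptime_const (A : Type) (e : A -> tree) n : ptime e (fun=> Nat n).
Proof.
exists (Const n), (fun=> nbits n); split; try exact: polybound_const.
by move=> a; exists (nbits n) => //; constructor.
Qed.

Lemma ptime_arith (A : Type) (e : A -> tree) (o : arith) (f g : A -> nat) :
  ptime e (fun a => Nat (f a)) -> ptime e (fun a => Nat (g a)) ->
  ptime e (fun a => Nat (arith_eval o (f a) (g a))).
Proof.
move=> H K; apply: ptime_seq (ptime_pair H K) _.
exists (Arith o), (fun a => nbits (f a) + nbits (g a)); split.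
- by move=> a; exists (nbits (f a) + nbits (g a)) => //; apply: exec_Arith.
- by apply: polybound_mono (polybound_refl _) _ => a /=.
- apply: polybound_mono (polybound_refl _) _ => a /=.
  by apply: leq_trans (nbits_arith _ _ _) _.
Qed.

Lemma ptime_if (A : Type) (e : A -> tree) (b : A -> bool) (f g : A -> tree) :
  ptime e (fun a => Nat (b a)) -> ptime e f -> ptime e g ->
  ptime e (fun a => if b a then f a else g a).
Proof.
move=> [r [v [L1 L2 L3]]] [p [t [H1 H2 H3]]] [q [u [K1 K2 K3]]].
exists (If r p q), (fun a => v a + (t a + u a) + 1); split.
- move=> a; have [t' le ex] := H1 a; have [u' le' ex'] := K1 a.
  have [v' le'' ex''] := L1 a; rewrite addn1.
  case: (b a) ex'' => ex''.
    exists (v' + t').+1; last exact: exec_If_true ex'' _ ex.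
    by rewrite ltnS leq_add // (leq_trans le) ?leq_addr.
  exists (v' + u').+1; last exact: exec_If_false ex'' _ ex'.
  by rewrite ltnS leq_add // (leq_trans le') ?leq_addl.
- apply: polybound_add _ (polybound_const _ 1).
  exact: polybound_add L2 (polybound_add H2 K2).
- apply: polybound_mono (polybound_add H3 K3) _ => a /=.
  by case: (b a); rewrite ?leq_addr ?leq_addl.
Qed.

Lemma ptime_ifn (A : Type) (e : A -> tree) (b : A -> bool) (f g : A -> nat) :
  ptime e (fun a => Nat (b a)) -> ptime e (fun a => Nat (f a)) -> ptime e (fun a => Nat (g a)) ->
  ptime e (fun a => Nat (if b a then f a else g a)).
Proof.
move=> H K L; apply: ptime_eq (ptime_if H K L) => a /=.
by case: (b a).
Qed.

Section Expressions.
Variables (A : Type) (e : A -> tree).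
Implicit Types (f g : A -> nat) (b c : A -> bool).

Lemma ptime_add f g : ptime e (fun a => Nat (f a)) -> ptime e (fun a => Nat (g a)) ->
  ptime e (fun a => Nat (f a + g a)).
Proof. exact: ptime_arith OpAdd _ _. Qed.

Lemma ptime_sub f g : ptime e (fun a => Nat (f a)) -> ptime e (fun a => Nat (g a)) ->
  ptime e (fun a => Nat (f a - g a)).
Proof. exact: ptime_arith OpSub _ _. Qed.

Lemma ptime_mul f g : ptime e (fun a => Nat (f a)) -> ptime e (fun a => Nat (g a)) ->
  ptime e (fun a => Nat (f a * g a)).
Proof. exact: ptime_arith OpMul _ _. Qed.

Lemma ptime_div f g : ptime e (fun a => Nat (f a)) -> ptime e (fun a => Nat (g a)) ->
  ptime e (fun a => Nat (f a %/ g a)).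
Proof. exact: ptime_arith OpDiv _ _. Qed.

Lemma ptime_succ f : ptime e (fun a => Nat (f a)) -> ptime e (fun a => Nat (f a).+1).
Proof.
move=> H; apply: ptime_eq (ptime_add H (ptime_const e 1)) => a.
by rewrite addn1.
Qed.

Lemma ptime_max f g : ptime e (fun a => Nat (f a)) -> ptime e (fun a => Nat (g a)) ->
  ptime e (fun a => Nat (maxn (f a) (g a))).
Proof.
move=> H K; apply: ptime_eq (ptime_add H (ptime_sub K H)) => a /=.
by rewrite -maxnE.
Qed.

Lemma ptime_min f g : ptime e (fun a => Nat (f a)) -> ptime e (fun a => Nat (g a)) ->
  ptime e (fun a => Nat (minn (f a) (g a))).
Proof.
move=> H K; apply: ptime_eq (ptime_sub H (ptime_sub H K)) => a /=.
by rewrite -minnE.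
Qed.

Lemma ptime_leq f g : ptime e (fun a => Nat (f a)) -> ptime e (fun a => Nat (g a)) ->
  ptime e (fun a => Nat (f a <= g a)).
Proof.
move=> H K.
have [p [t [L1 L2 L3]]] := ptime_sub H K.
exists (If p (Const 0) (Const 1)), (fun a => t a + 2); split.
- move=> a; have [t' le ex] := L1 a.
  exists (t' + 1).+1; first by lia.
  rewrite /leq; case: (f a - g a) ex => [|n] ex.
    exact: exec_If_false ex _ (exec_Const 1 _).
  exact: exec_If_true ex _ (exec_Const 0 _).
- exact: polybound_add L2 (polybound_const _ 2).
- apply: polybound_mono (polybound_const _ 1) _ => a.
  by rewrite /= nbits_bool.
Qed.

Lemma ptime_and b c :
  ptime e (fun a => Nat (b a)) -> ptime e (fun a => Nat (c a)) ->
  ptime e (fun a => Nat (b a && c a)).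
Proof.
move=> H K; apply: ptime_eq (ptime_if H K (ptime_const e 0)) => a.
by case: (b a).
Qed.

Lemma ptime_eqn f g : ptime e (fun a => Nat (f a)) -> ptime e (fun a => Nat (g a)) ->
  ptime e (fun a => Nat (f a == g a)).
Proof.
move=> H K; apply: ptime_eq (ptime_and (ptime_leq H K) (ptime_leq K H)) => a.
by rewrite eqn_leq.
Qed.

Lemma ptime_imply b c :
  ptime e (fun a => Nat (b a)) -> ptime e (fun a => Nat (c a)) ->
  ptime e (fun a => Nat (b a ==> c a)).
Proof.
move=> H K; apply: ptime_eq (ptime_if H K (ptime_const e 1)) => a.
by case: (b a).
Qed.

End Expressions.

(** * Loops over lists *)

Definition enc_list (B : Type) (c : B -> tree) (l : seq B) : tree :=
  encode_list (map c l).

Fixpoint fold_suffix (B S : Type) (f : S -> B -> seq B -> S) (s : S) (l : seq B) : S :=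
  if l is x :: l' then fold_suffix f (f s x l') l' else s.

Definition enc_suffix (B : Type) (c : B -> tree) (y : B * seq B) : tree :=
  Pair (c y.1) (enc_list c y.2).

Section Loop.
Variables (A B S : Type) (e : A -> tree) (c : B -> tree) (k : S -> tree).
Variables (l : A -> seq B) (s0 : A -> S) (f : A -> S -> B -> seq B -> S).
Variables (P : A -> S -> seq B -> Prop) (tau : A -> nat).
Hypothesis init : forall a, P a (s0 a) (l a).
Hypothesis next : forall a s x l', P a s (x :: l') -> P a (f a s x l') l'.
Hypothesis bound : forall a s l',
  P a s l' -> vsize (k s) + vsize (enc_list c l') <= tau a.
Hypothesis tau_poly : polybound (vsize \o e) tau.

Lemma fold_suffix_inv a s l' : P a s l' -> P a (fold_suffix (f a) s l') [::].
Proof. by elim: l' s => [|x l' IH] //= s /next /IH. Qed.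

Lemma ptime_fold_suffix :
  ptime e (fun a => enc_list c (l a)) -> ptime e (fun a => k (s0 a)) ->
  ptime (ctx (ctx e k) (enc_suffix c)) (fun z => k (f z.1.1 z.1.2 z.2.1 z.2.2)) ->
  ptime e (fun a => k (fold_suffix (f a) (s0 a) (l a))).
Proof.
move=> Hl Hs [p [tb [B1 [d B2] B3]]].
apply: (@ptime_seq _ _ (fun a => Pair (e a) (Pair (enc_list c (l a)) (k (s0 a))))).
  by apply: ptime_pair (ptime_id e) (ptime_pair Hl Hs).
apply: (@ptime_seq _ _ (fun a =>
  Pair (e a) (Pair (Nat 0) (k (fold_suffix (f a) (s0 a) (l a)))))); last first.
  exact/ptime_right/ptime_right/ptime_id.
set e1 := fun a => Pair _ (Pair (enc_list _ _) _).
pose shuffle := Fork (Fork Fst (Seq Snd Snd)) (Seq Snd Fst).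
pose body := Fork Fst (Fork (Seq Snd (Seq Fst Snd)) (Seq shuffle p)).
pose w a := 30 + (vsize (e a) + tau a + 2 + 2) ^ d.
have ex_loop a s l' : P a s l' -> exists2 t, t <= size l' * w a + w a &
    exec (While (Seq Snd (Seq Fst IsPair)) body)
      (Pair (e a) (Pair (enc_list c l') (k s)))
      (Pair (e a) (Pair (Nat 0) (k (fold_suffix (f a) s l')))) t.
  elim: l' s => [|x l' IH] s Ps.
    exists 6; first by rewrite /w; lia.
    apply: (@exec_While_stop _ _ _ (Nat 0) 5) => //.
    apply: (exec_Seq (t := 1) (u := 3)); first exact: exec_Snd.
    apply: (exec_Seq (t := 1) (u := 1)); first exact: exec_Fst.
    exact: (exec_IsPair (Nat 0)).
  have [t le ex] := IH _ (next Ps).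
  have [u le' ex'] := B1 ((a, s), (x, l')).
  exists (5 + (1 + (5 + (((1 + 3).+1 + 3).+1 + u).+1).+1).+1 + t).+1.
    have : u <= (vsize (e a) + tau a + 2 + 2) ^ d.
      apply: leq_trans le' _; apply: leq_trans (B2 _) _ => /=.
      case: (d) => // d'; rewrite leq_exp2r //.
      have /= := bound Ps; rewrite /enc_list /=; lia.
    have -> : size (x :: l') * w a = w a + size l' * w a by rewrite mulSn.
    by rewrite {1}/w; lia.
  apply: exec_While_step ex => //.
  - apply: (exec_Seq (t := 1) (u := 3)); first exact: exec_Snd.
    apply: (exec_Seq (t := 1) (u := 1)); first exact: exec_Fst.
    exact: exec_IsPair.
  - by [].
  - apply: exec_Fork; first exact: exec_Fst.
    apply: exec_Fork.
      apply: (exec_Seq (t := 1) (u := 3)); first exact: exec_Snd.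
      apply: (exec_Seq (t := 1) (u := 1)); first exact: exec_Fst.
      exact: exec_Snd.
    apply: exec_Seq ex'; apply: exec_Fork.
      apply: exec_Fork; first exact: exec_Fst.
      by apply: (exec_Seq (t := 1) (u := 1)); exact: exec_Snd.
    by apply: (exec_Seq (t := 1) (u := 1)); [exact: exec_Snd | exact: exec_Fst].
have le_e a : vsize (e a) <= vsize (e1 a) by rewrite /e1 /=; lia.
have tau1 : polybound (vsize \o e1) tau.
  by apply: polybound_trans tau_poly; apply: polybound_mono (polybound_refl _) le_e.
exists (While (Seq Snd (Seq Fst IsPair)) body), (fun a => size (l a) * w a + w a).
split.
- by move=> a; apply: ex_loop.
- have w1 : polybound (vsize \o e1) w.
    apply: polybound_add (polybound_const _ _) _.
    have : polybound (vsize \o e1) (fun a => vsize (e a) + tau a).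
      apply: polybound_add tau1.
      by apply: polybound_mono (polybound_refl _) le_e.
    move=> /(polybound_add (polybound_const _ 2)) H; apply: polybound_trans H _.
    by exists d => a; rewrite [2 + _]addnC.
  apply: polybound_add (w1); apply: polybound_mul (w1).
  apply: polybound_mono (polybound_refl _) _ => a; rewrite /e1 /= /enc_list.
  have : size (l a) <= vsize (encode_list (map c (l a))); last by lia.
  by elim: (l a) => //= x l' IH; lia.
- apply: polybound_mono
    (polybound_add (polybound_refl _) (polybound_add tau1 (polybound_const _ 5))) _ => a /=.
  have := bound (fold_suffix_inv (init a)); have := le_e a; rewrite /e1 /=; lia.
Qed.

End Loop.

Lemma ptime_iter (A B S : Type) (e : A -> tree) (c : B -> tree) (k : S -> tree)
    (l : A -> seq B) (s0 : A -> S) (f : A -> S -> S) (tau : A -> nat) :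
  ptime e (fun a => enc_list c (l a)) -> ptime e (fun a => k (s0 a)) ->
  ptime (ctx e k) (fun z => k (f z.1 z.2)) ->
  polybound (vsize \o e) tau ->
  (forall a i, i <= size (l a) -> vsize (k (iter i (f a) (s0 a))) <= tau a) ->
  ptime e (fun a => k (iter (size (l a)) (f a) (s0 a))).
Proof.
move=> Hl Hs Hf Ht bnd.
pose P a s (l' : seq B) := [/\ size l' <= size (l a),
  vsize (enc_list c l') <= vsize (enc_list c (l a)) &
  s = iter (size (l a) - size l') (f a) (s0 a)].
suff: ptime e (fun a => k (fold_suffix (fun s _ _ => f a s) (s0 a) (l a))).
  move=> H; apply: ptime_eq H => a; congr (k _).
  by elim: (l a) (s0 a) => //= x l' IH s; rewrite IH -iterSr.
refine (@ptime_fold_suffix A B S e c k l s0 (fun a s _ _ => f a s) P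
  (fun a => tau a + vsize (enc_list c (l a))) _ _ _ _ _ _ _).
- by move=> a; split=> //; rewrite subnn.
- move=> a s x l' [le le' ->]; split; first exact: (ltnW le).
    by move: le'; rewrite /enc_list /=; lia.
  by rewrite -iterS; congr (iter _ (f a) (s0 a)); rewrite /= in le *; lia.
- move=> a s l' [le le' ->]; apply: leq_add le'; apply: bnd.
  exact: leq_subr.
- by apply: polybound_add Ht _; case: Hl => [? [? []]].
- by [].
- by [].
- pose h (z : A * S * (B * seq B)) := z.1.
  apply: (ptime_comp (h := h)) Hf.
  exact: ptime_left (ptime_id _).
Qed.

Lemma size_enc_list (B : Type) (c : B -> tree) (s : seq B) : size s <= vsize (enc_list c s).
Proof. by rewrite /enc_list; elim: s => //= x s; lia. Qed.

Lemma polybound_list (A B : Type) (e : A -> tree) (c : B -> tree) (l : A -> seq B) :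
  ptime e (fun a => enc_list c (l a)) -> polybound (vsize \o e) (fun a => vsize (enc_list c (l a))).
Proof. by case=> [? [? []]]. Qed.

Lemma ptime_rev (A B : Type) (e : A -> tree) (c : B -> tree) (l : A -> seq B) :
  ptime e (fun a => enc_list c (l a)) -> ptime e (fun a => enc_list c (rev (l a))).
Proof.
move=> Hl; suff: ptime e (fun a => enc_list c (fold_suffix (fun s x _ => x :: s) [::] (l a))).
  move=> H; apply: ptime_eq H => a; congr (enc_list c _).
  by rewrite /rev; elim: (l a) [::] => //= x l' IH s; rewrite IH.
refine (@ptime_fold_suffix A B (seq B) e c (enc_list c) l (fun=> [::])
  (fun _ s x _ => x :: s)
  (fun a s l' => vsize (enc_list c s) + vsize (enc_list c l')
                  <= vsize (enc_list c (l a)) + 1)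
  (fun a => vsize (enc_list c (l a)) + 1) _ _ _ _ _ _ _).
- by move=> a; rewrite addnC.
- by move=> a s x l'; rewrite /enc_list /=; lia.
- by [].
- exact: polybound_add (polybound_list Hl) (polybound_const _ 1).
- exact: Hl.
- exact: ptime_const.
- apply: ptime_pair.
    exact/ptime_left/ptime_right/ptime_id.
  exact/ptime_right/ptime_left/ptime_id.
Qed.

Section ListOperations.
Variables (A B : Type) (e : A -> tree) (c : B -> tree) (l : A -> seq B).
Hypothesis Hl : ptime e (fun a => enc_list c (l a)).

Fixpoint map_suffix (C : Type) (f : B -> seq B -> C) (s : seq B) : seq C :=
  if s is x :: s' then f x s' :: map_suffix f s' else [::].

Lemma ptime_map_suffix (C : Type) (d : C -> tree) (f : A -> B -> seq B -> C) :
  ptime (ctx e (enc_suffix c)) (fun z => d (f z.1 z.2.1 z.2.2)) ->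
  ptime e (fun a => enc_list d (map_suffix (f a) (l a))).
Proof.
move=> Hf; have [_ [_ [_ _ [m Hm]]]] := Hf.
pose M a := (vsize (e a) + vsize (enc_list c (l a)) + 1 + 2) ^ m + 1.
have M_poly : polybound (vsize \o e) M.
  apply: polybound_add _ (polybound_const _ 1).
  have H : polybound (vsize \o e) (fun a => vsize (e a) + vsize (enc_list c (l a)) + 1).
    apply: polybound_add _ (polybound_const _ 1).
    exact: polybound_add (polybound_refl _) (polybound_list Hl).
  by apply: polybound_trans H _; exists m.
pose P a (s : seq C) (l' : seq B) :=
  vsize (enc_list c l') <= vsize (enc_list c (l a)) /\
  vsize (enc_list d s) + size l' * M a <= vsize (enc_list c (l a)) * M a + 1.
have H : ptime e (fun a => enc_list d
    (fold_suffix (fun s x l' => f a x l' :: s) [::] (l a))).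
  refine (@ptime_fold_suffix A B (seq C) e c (enc_list d) l (fun=> [::])
    (fun a s x l' => f a x l' :: s) P
    (fun a => vsize (enc_list c (l a)) * M a + 1 + vsize (enc_list c (l a)))
    _ _ _ _ _ _ _).
  - move=> a; split=> //; rewrite addnC leq_add //.
    by rewrite leq_mul2r size_enc_list orbT.
  - move=> a s x l' [le1 le2]; split; first by move: le1; rewrite /enc_list /=; lia.
    have : vsize (d (f a x l')) + 1 <= M a.
      rewrite leq_add2r; apply: leq_trans (Hm (a, (x, l'))) _ => /=.
      case: (m) => // m'; rewrite leq_exp2r //.
      by move: le1; rewrite /enc_list /=; lia.
    by move: le2; rewrite /enc_list /= mulSn; lia.
  - by move=> a s l' [le1 le2]; lia.
  - exact: polybound_add (polybound_add (polybound_mul (polybound_list Hl) M_poly)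
      (polybound_const _ _)) (polybound_list Hl).
  - exact: Hl.
  - exact: ptime_const.
  - apply: ptime_pair; last exact/ptime_right/ptime_left/ptime_id.
    pose h (z : A * seq C * (B * seq B)) := (z.1.1, z.2).
    apply: (ptime_comp (h := h)) Hf; apply: ptime_pair.
      exact/ptime_left/ptime_left/ptime_id.
    exact/ptime_right/ptime_id.
apply: ptime_eq (ptime_rev H) => a; congr (enc_list d _) => /=.
suff E s l' : rev (fold_suffix (fun s x l' => f a x l' :: s) s l') =
    rev s ++ map_suffix (f a) l' by rewrite E.
elim: l' s => [|x l' IH] s /=; first by rewrite cats0.
by rewrite IH rev_cons cat_rcons.
Qed.

Lemma ptime_map (C : Type) (d : C -> tree) (f : A -> B -> C) :
  ptime (ctx e c) (fun z => d (f z.1 z.2)) ->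
  ptime e (fun a => enc_list d (map (f a) (l a))).
Proof.
move=> Hf; have := @ptime_map_suffix C d (fun a x _ => f a x).
have E a : map_suffix (fun x _ => f a x) (l a) = map (f a) (l a).
  by elim: (l a) => //= x l' ->.
move=> H; apply: ptime_eq (H _) => [a|]; first by rewrite E.
pose h (z : A * (B * seq B)) := (z.1, z.2.1).
apply: (ptime_comp (h := h)) Hf; apply: ptime_pair.
  exact/ptime_left/ptime_id.
exact/ptime_left/ptime_right/ptime_id.
Qed.

Lemma ptime_big (idx : nat) (op : Monoid.com_law idx) (F : A -> B -> nat) :
  (forall m n, nbits (op m n) <= nbits m + nbits n) ->
  (forall (A' : Type) (e' : A' -> tree) (f g : A' -> nat),
    ptime e' (fun a => Nat (f a)) -> ptime e' (fun a => Nat (g a)) ->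
    ptime e' (fun a => Nat (op (f a) (g a)))) ->
  ptime (ctx e c) (fun z => Nat (F z.1 z.2)) ->
  ptime e (fun a => Nat (\big[op/idx]_(x <- l a) F a x)).
Proof.
move=> op_size op_ptime HF; have [_ [_ [_ _ [m Hm]]]] := HF.
pose M a := (vsize (e a) + vsize (enc_list c (l a)) + 1 + 2) ^ m.
have M_poly : polybound (vsize \o e) M.
  have H : polybound (vsize \o e) (fun a => vsize (e a) + vsize (enc_list c (l a)) + 1).
    apply: polybound_add _ (polybound_const _ 1).
    exact: polybound_add (polybound_refl _) (polybound_list Hl).
  by apply: polybound_trans H _; exists m.
pose P a (s : nat) (l' : seq B) :=
  vsize (enc_list c l') <= vsize (enc_list c (l a)) /\
  nbits s + size l' * M a <= vsize (enc_list c (l a)) * M a + nbits idx.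
have H : ptime e (fun a => Nat
    (fold_suffix (fun s x l' => op s (F a x)) idx (l a))).
  refine (@ptime_fold_suffix A B nat e c Nat l (fun=> idx)
    (fun a s x l' => op s (F a x)) P
    (fun a => vsize (enc_list c (l a)) * M a + nbits idx + vsize (enc_list c (l a)))
    _ _ _ _ _ _ _).
  - move=> a; split=> //; rewrite addnC leq_add //.
    by rewrite leq_mul2r size_enc_list orbT.
  - move=> a s x l' [le1 le2]; split; first by move: le1; rewrite /enc_list /=; lia.
    have : nbits (F a x) <= M a.
      apply: leq_trans (Hm (a, x)) _; rewrite /M /=.
      case: (m) => // m'; rewrite leq_exp2r //.
      by move: le1; rewrite /enc_list /=; lia.
    have := op_size s (F a x).
    by move: le2; rewrite /= mulSn; lia.
  - by move=> a s l' [le1 le2] /=; lia.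
  - exact: polybound_add (polybound_add (polybound_mul (polybound_list Hl) M_poly)
      (polybound_const _ _)) (polybound_list Hl).
  - exact: Hl.
  - exact: ptime_const.
  - apply: op_ptime.
      exact/ptime_right/ptime_left/ptime_id.
    pose h (z : A * nat * (B * seq B)) := (z.1.1, z.2.1).
    apply: (ptime_comp (h := h)) HF; apply: ptime_pair.
      exact/ptime_left/ptime_left/ptime_id.
    exact/ptime_left/ptime_right/ptime_id.
apply: ptime_eq H => a; congr Nat.
suff E s l' : fold_suffix (fun s x l' => op s (F a x)) s l' =
    op s (\big[op/idx]_(x <- l') F a x) by rewrite E Monoid.mul1m.
elim: l' s => [|x l' IH] s /=; first by rewrite big_nil Monoid.mulm1.
by rewrite IH big_cons Monoid.mulmA.
Qed.

Lemma ptime_sum (F : A -> B -> nat) :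
  ptime (ctx e c) (fun z => Nat (F z.1 z.2)) ->
  ptime e (fun a => Nat (\sum_(x <- l a) F a x)).
Proof. exact: (ptime_big nbits_add ptime_add). Qed.

Lemma ptime_prod (F : A -> B -> nat) :
  ptime (ctx e c) (fun z => Nat (F z.1 z.2)) ->
  ptime e (fun a => Nat (\prod_(x <- l a) F a x)).
Proof. exact: (ptime_big nbits_mul ptime_mul). Qed.

Lemma ptime_bigmax (F : A -> B -> nat) :
  ptime (ctx e c) (fun z => Nat (F z.1 z.2)) ->
  ptime e (fun a => Nat (\max_(x <- l a) F a x)).
Proof.
apply: ptime_big ptime_max => m n; rewrite /= maxnE.
by apply: leq_trans (leq_nbits _) (nbits_add m n); lia.
Qed.

Lemma ptime_all (F : A -> B -> bool) :
  ptime (ctx e c) (fun z => Nat (F z.1 z.2)) ->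
  ptime e (fun a => Nat (all (F a) (l a))).
Proof.
move=> H; apply: ptime_eq (ptime_prod (F := fun a x => F a x) H) => a; congr Nat.
elim: (l a) => [|x l' IH] /=; first by rewrite big_nil.
by rewrite big_cons IH mulnb.
Qed.

End ListOperations.

(** * The algorithm on integral data *)

Record static := Static { uid : nat; begins : nat; ends : nat; wt : nat; multi : bool }.

(* [rnk] is the rank of the item in the order of selection, 0 for an item that is
   not selected. *)
Record item := Item { data :> static; cst : nat; rnk : nat; mul : nat }.

Definition act (x : static) (t : nat) : bool := begins x <= t <= ends x.

Definition load (l : seq item) (t : nat) : nat :=
  \sum_(x <- l) if act x t then mul x * wt x else 0.

Definition resid (l : seq item) (u : nat * nat) : nat := u.2 - load l u.1.

Definition ceil_div (m n : nat) : nat := (m + n - 1) %/ n.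

Definition top_rank (l : seq item) : nat := \max_(x <- l) rnk x.

Section Algorithm.
Variable ds : seq (nat * nat).
Implicit Types (l : seq item) (x : item).

Definition peak l : nat := \max_(u <- ds) resid l u.

Definition peak_time l : nat :=
  \max_(u <- ds) if resid l u == peak l then u.1 else 0.

Definition eff l x : nat := minn (wt x) (peak l).

Definition cand l x : bool :=
  (0 < peak l) && ((rnk x == 0) && ((0 < wt x) && act x (peak_time l))).

Definition cheapest l x : bool :=
  all (fun y => cand l y ==> (cst x * eff l y <= cst y * eff l x)) l.

(* Since identifiers are positive, 0 means that there is no candidate. *)
Definition best l : nat :=
  \max_(x <- l) if cand l x && cheapest l x then uid x else 0.

Definition best_cost l : nat := \max_(x <- l) if uid x == best l then cst x else 0.
Definition best_eff l : nat := \max_(x <- l) if uid x == best l then eff l x else 0.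

(* Costs are multiplied by [best_eff] so as to remain integral. *)
Definition new_cost l x : nat :=
  if (rnk x == 0) && act x (peak_time l)
  then cst x * best_eff l - best_cost l * eff l x else cst x * best_eff l.

Definition initial_mul l x : nat := if multi x then ceil_div (peak l) (wt x) else 1.

Definition forward_item l x : item :=
  Item x (new_cost l x)
    (if uid x == best l then (top_rank l).+1 else rnk x)
    (if uid x == best l then initial_mul l x else mul x).

Definition forward l : seq item := if best l == 0 then l else map (forward_item l) l.

Definition needed l x : nat :=
  \max_(u <- ds) if act x u.1
    then ceil_div (u.2 - (load l u.1 - mul x * wt x)) (wt x) else 0.

Definition backward l : seq item :=
  [seq if (0 < rnk x) && (rnk x == top_rank l) then Item x (cst x) 0 (needed l x) else x
  | x <- l].

Definition solve l : seq item :=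
  iter (size l) backward (iter (size l) forward l).

End Algorithm.

(** * Approximation factor *)

Lemma bigmax_attained (A : eqType) (s : seq A) (F : A -> nat) :
  0 < \max_(x <- s) F x -> exists2 x, x \in s & F x = \max_(y <- s) F y.
Proof.
elim: s => [|a s IH]; first by rewrite big_nil.
rewrite big_cons; case: (leqP (F a) (\max_(x <- s) F x)) => le.
  move=> /IH [x xs E]; exists x => //.
  by rewrite in_cons xs orbT.
move=> _; exists a => //; exact: mem_head.
Qed.

Lemma leq_bigmax_mem (A : eqType) (s : seq A) (F : A -> nat) x :
  x \in s -> F x <= \max_(y <- s) F y.
Proof. by move=> xs; apply: leq_bigmax_seq. Qed.

Lemma ceil_divP m n k : 0 < n -> (ceil_div m n <= k) = (m <= k * n).
Proof.
move=> n0; rewrite /ceil_div -ltnS ltn_divLR // mulSn.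
by apply/idP/idP; lia.
Qed.

Lemma leq_ceil_div m n : ceil_div m n <= m.
Proof.
case: (posnP n) => [->|n0]; first by rewrite /ceil_div divn0.
by rewrite ceil_divP // leq_pmulr.
Qed.

Section Charging.
Variables (I : finType) (U : pred I) (lo hi v mu : I -> nat) (tau D : nat).
Let on i t := lo i <= t <= hi i.
Let charge i := mu i * minn (v i) D.

Let tight i t := on i t && (\sum_(j | U j && on j t) mu j * v j < D + v i).

Lemma charging_side (P : pred I) i t :
  P i -> 0 < mu i -> tight i t -> (forall j, P j -> 0 < mu j -> U j && on j t) ->
  \sum_(j | P j) charge j <= 2 * D.
Proof.
move=> Pi mui /andP [_ lt] H.
have le : \sum_(j | P j) mu j * v j <= \sum_(j | U j && on j t) mu j * v j.
  rewrite [X in X <= _]big_mkcond [X in _ <= X]big_mkcond; apply: leq_sum => j _.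
  case Pj: (P j) => //; case: (posnP (mu j)) => [->|/(H _ Pj) ->] //.
move: (leq_ltn_trans le lt); rewrite (bigD1 i) //= => lt'.
rewrite (bigD1 i) //=.
have : \sum_(j | P j && (j != i)) charge j <= \sum_(j | P j && (j != i)) mu j * v j.
  by apply: leq_sum => j _; rewrite leq_mul2l geq_minl orbT.
rewrite /charge; case: (leqP (v i) D) => leD; first by lia.
by case: (mu i) mui lt' => // k _; rewrite !mulSn; nia.
Qed.

(* Split by the side of [tau] on which the tight slot lies: all resources of one
   side are active at the tight slot nearest to [tau]. *)
Lemma charging :
  (forall i, U i -> on i tau -> 0 < mu i -> exists t, tight i t) ->
  \sum_(i | U i && on i tau) charge i <= 4 * D.
Proof.
move=> H.
have /fin_all_exists [t Ht] :
    forall i, exists t, [&& U i, on i tau & 0 < mu i] -> tight i t.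
  move=> i; case E: [&& _, _ & _]; last by exists 0.
  by case/and3P: E => /H /[apply] /[apply] -[t Ht]; exists t.
pose Pl i := U i && on i tau && (t i <= tau).
pose Pr i := U i && on i tau && ~~ (t i <= tau).
rewrite (bigID (fun i => t i <= tau)) /= (_ : 4 * D = 2 * D + 2 * D); last by lia.
have tightP i : U i && on i tau -> 0 < mu i -> tight i (t i).
  by move=> /andP [h1 h2] h3; apply: Ht; rewrite h1 h2.
apply: leq_add.
- case: (pickP (fun i => Pl i && (0 < mu i))) => [i0 Hi0|none]; last first.
    rewrite big1 // => i Pi; have := none i; rewrite /Pl Pi /= lt0n => /negbFE /eqP E.
    by rewrite /charge E.
  case: (@arg_maxnP I i0 (fun i => Pl i && (0 < mu i)) t Hi0) => i /andP [Pi mui] max.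
  apply: (charging_side (P := Pl) Pi mui); first by apply: tightP => //; case/andP: Pi.
  move=> j Pj muj; case/andP: (Pj) => Uj tj.
  have /andP [/andP [h1 h2] _] := tightP _ Uj muj.
  have le : t j <= t i by apply: max; rewrite Pj.
  case/andP: Uj => -> /andP [h3 h4] /=; rewrite /on.
  move: (Pi) => /andP [_ h5]; lia.
- case: (pickP (fun i => Pr i && (0 < mu i))) => [i0 Hi0|none]; last first.
    rewrite big1 // => i Pi; have := none i; rewrite /Pr Pi /= lt0n => /negbFE /eqP E.
    by rewrite /charge E.
  case: (@arg_minnP I i0 (fun i => Pr i && (0 < mu i)) t Hi0) => i /andP [Pi mui] min.
  apply: (charging_side (P := Pr) Pi mui); first by apply: tightP => //; case/andP: Pi.
  move=> j Pj muj; case/andP: (Pj) => Uj tj.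
  have /andP [/andP [h1 h2] _] := tightP _ Uj muj.
  have le : t i <= t j by apply: min; rewrite Pj.
  case/andP: Uj => -> /andP [h3 h4] /=; rewrite /on.
  move: (Pi) => /andP [_ h5]; lia.
Qed.

End Charging.

Section LocalRatio.
Variables (I : finType) (ds : seq (nat * nat)).
Implicit Types (x y : I -> item) (m : I -> nat) (i j b : I).

Definition listing x : seq item := [seq x i | i <- enum I].

Lemma big_listing (R : Type) (idx : R) (op : R -> R -> R) x (F : item -> R) :
  \big[op/idx]_(z <- listing x) F z = \big[op/idx]_i F (x i).
Proof. by rewrite big_map enumT /index_enum; case: index_enum_key. Qed.

Lemma load_listing x t : load (listing x) t = \sum_(i | act (x i) t) mul (x i) * wt (x i).
Proof. by rewrite /load big_listing -big_mkcond. Qed.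

Lemma leq_top_rank x i : rnk (x i) <= top_rank (listing x).
Proof. by rewrite /top_rank big_listing; apply: leq_bigmax. Qed.

Record inv x : Prop := Inv {
  inv_uid : injective (fun i => uid (x i));
  inv_uid_gt0 : forall i, 0 < uid (x i);
  inv_mul : forall i, rnk (x i) = 0 -> mul (x i) = 0;
  inv_wt : forall i, 0 < rnk (x i) -> 0 < wt (x i);
  inv_rnk : forall i j, 0 < rnk (x i) -> rnk (x i) = rnk (x j) -> i = j;
  inv_single : forall i, ~~ multi (x i) -> mul (x i) <= 1 }.

(* A selected M-type resource leaves no residual demand on its interval, and of
   a selected S-type resource [m] has at most the one copy already counted; so
   [m] covers the residual demand without the selected resources. *)
Definition covers x m : Prop :=
  (forall i, ~~ multi (x i) -> m i <= 1) /\
  forall u : nat * nat, u \in ds -> 0 < resid (listing x) u ->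
    resid (listing x) u <= \sum_(i | (rnk (x i) == 0) && act (x i) u.1) m i * wt (x i).

Definition critical y i : Prop :=
  exists2 u : nat * nat, u \in ds & act (y i) u.1 && (load (listing y) u.1 < u.2 + wt (y i)).

Record outcome x y : Prop := Outcome {
  out_data : forall i, data (y i) = data (x i);
  out_selected : forall i, 0 < rnk (x i) ->
    rnk (y i) = rnk (x i) /\ mul (y i) = mul (x i);
  out_rnk : forall i, rnk (x i) = 0 -> rnk (y i) = 0;
  out_single : forall i, ~~ multi (y i) -> mul (y i) <= 1;
  out_cover : forall u : nat * nat, u \in ds -> u.2 <= load (listing y) u.1;
  out_critical : forall i, rnk (x i) = 0 -> 0 < mul (y i) -> critical y i }.

Definition weight x (v : I -> nat) : nat := \sum_(i | rnk (x i) == 0) v i * cst (x i).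

Section Peak.
Variable x : I -> item.
Hypothesis inv_x : inv x.
Let l := listing x.
Let D := peak ds l.
Let tau := peak_time ds l.
Hypothesis D_gt0 : 0 < D.

Lemma peakP : exists2 u : nat * nat, u \in ds & u.1 = tau /\ resid l u = D.
Proof.
have [u0 u0ds E0] := bigmax_attained D_gt0.
pose F u := if resid l u == D then u.1 else 0.
case: (posnP tau) => [tau0|tau_gt0].
  exists u0 => //; split=> //; rewrite tau0; apply/eqP; rewrite -leqn0 -tau0.
  have := leq_bigmax_mem F u0ds; rewrite {1}/F /= E0 eqxx; exact.
have [u uds E] := bigmax_attained tau_gt0; exists u => //.
move: E; rewrite -/tau; case: eqP => [//|_ E].
by move: tau_gt0; rewrite /tau /peak_time -E.
Qed.

Lemma bestP m : covers x m ->
  exists b, [/\ cand ds l (x b), uid (x b) = best ds l &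
    forall j, cand ds l (x j) ->
      cst (x b) * eff ds l (x j) <= cst (x j) * eff ds l (x b)].
Proof.
move=> [_ cov]; have [u uds [Eu Du]] := peakP.
have [i0 ci0] : exists i, cand ds l (x i).
  have := cov u uds; rewrite -/l Du => /(_ D_gt0) le.
  move: (leq_trans D_gt0 le); rewrite lt0n sum_nat_eq0 negb_forall => /existsP [i].
  rewrite negb_imply Eu => /andP [/andP [ri ai]]; rewrite muln_eq0 negb_or -!lt0n => /andP [_ wi].
  by exists i; rewrite /cand; apply/and4P.
pose ratio i : rat := ((cst (x i))%:R / (eff ds l (x i))%:R)%R.
have effP i : cand ds l (x i) -> (0 < (eff ds l (x i))%:R :> rat)%R.
  by move=> /and4P [h1 _ h3 _]; rewrite ltr0n leq_min h3.
have ratioP i j : cand ds l (x i) -> cand ds l (x j) ->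
    (ratio i <= ratio j)%R = (cst (x i) * eff ds l (x j) <= cst (x j) * eff ds l (x i)).
  move=> /effP ci /effP cj.
  by rewrite /ratio ler_pdivrMr // mulrAC ler_pdivlMr // -!natrM ler_nat.
have [b cb min] := @arg_minP _ _ I i0 (fun i => cand ds l (x i)) ratio ci0.
have cheapestP i : cheapest ds l (x i) =
    [forall j, cand ds l (x j) ==>
      (cst (x i) * eff ds l (x j) <= cst (x j) * eff ds l (x i))].
  rewrite /cheapest /l /listing all_map.
  by apply/allP/forallP => [H j|H j _]; apply: H; rewrite ?mem_enum.
have cheap : cand ds l (x b) && cheapest ds l (x b).
  rewrite cb cheapestP; apply/forallP => j; apply/implyP => cj.
  by rewrite -ratioP //; apply: min.
have best_gt0 : 0 < best ds l.
  apply: leq_trans (inv_uid_gt0 inv_x b) _.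
  rewrite /best big_listing; apply: leq_trans (leq_bigmax b).
  by rewrite cheap.
move: (best_gt0); rewrite {1}/best big_listing => /bigmax_attained [i _].
rewrite -(big_listing _ _ _ (fun z => if cand ds l z && cheapest ds l z then uid z else 0)).
rewrite -/l -/(best ds l) cheapestP; case: ifP => [/andP [ci /forallP chp] E|_ E].
  by exists i; split=> // j cj; have /implyP := chp j; apply.
by move: best_gt0; rewrite -E.
Qed.

End Peak.

Definition fwd x b i : item :=
  let l := listing x in
  Item (x i)
    (if (rnk (x i) == 0) && act (x i) (peak_time ds l)
     then cst (x i) * eff ds l (x b) - cst (x b) * eff ds l (x i)
     else cst (x i) * eff ds l (x b))
    (if i == b then (top_rank l).+1 else rnk (x i))
    (if i == b then initial_mul ds l (x i) else mul (x i)).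

Lemma forward_listing x b : inv x -> uid (x b) = best ds (listing x) ->
  forward ds (listing x) = listing (fwd x b).
Proof.
move=> ix E; rewrite /forward -E eqn0Ngt inv_uid_gt0 //= /listing -map_comp.
have eq_b i : (uid (x i) == uid (x b)) = (i == b).
  by rewrite (inj_eq (inv_uid ix)).
have pick (F : item -> nat) :
    \max_(z <- listing x) (if uid z == best ds (listing x) then F z else 0) = F (x b).
  rewrite big_listing -E -big_mkcond (eq_bigl _ _ eq_b); exact: big_pred1_eq.
apply: eq_map => i /=.
by rewrite /fwd /forward_item /new_cost /best_eff /best_cost !pick -/(listing x) -E eq_b.
Qed.

Definition bwd y b i : item :=
  if i == b then Item (y i) (cst (y i)) 0 (needed ds (listing y) (y i)) else y i.

Lemma backward_listing y b : 0 < rnk (y b) ->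
  (forall i, i != b -> rnk (y i) < rnk (y b)) ->
  backward ds (listing y) = listing (bwd y b).
Proof.
move=> rb lt; have E : top_rank (listing y) = rnk (y b).
  apply/eqP; rewrite eqn_leq leq_top_rank andbT /top_rank big_listing.
  by apply/bigmax_leqP => i _; case: (eqVneq i b) => [->|/lt/ltnW].
rewrite /backward E /listing -map_comp; apply: eq_map => i /=; rewrite /bwd.
case: (eqVneq i b) => [->|/lt]; first by rewrite rb eqxx.
by move=> h; rewrite (ltn_eqF h) andbF.
Qed.

Lemma forward_id x : peak ds (listing x) = 0 -> forward ds (listing x) = listing x.
Proof.
move=> D0; rewrite /forward; suff -> : best ds (listing x) = 0 by [].
by rewrite /best big1 // => z _; rewrite /cand D0.
Qed.

Section Round.
Variables (x : I -> item) (m : I -> nat) (b : I).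
Hypotheses (inv_x : inv x) (cov_x : covers x m).
Let l := listing x.
Let D := peak ds l.
Let tau := peak_time ds l.
Let e i := eff ds l (x i).
Hypothesis D_gt0 : 0 < D.
Hypothesis cand_b : cand ds l (x b).
Hypothesis cheap_b : forall j, cand ds l (x j) ->
  cst (x b) * e j <= cst (x j) * e b.
Let x1 := fwd x b.

Let rnk_b : rnk (x b) = 0. Proof. by case/and4P: cand_b => _ /eqP. Qed.
Let wt_b : 0 < wt (x b). Proof. by case/and4P: cand_b. Qed.
Let act_b : act (x b) tau. Proof. by case/and4P: cand_b. Qed.
Let mul_b : mul (x b) = 0. Proof. exact: inv_mul. Qed.
Let e_b : 0 < e b. Proof. by rewrite /e /eff leq_min wt_b. Qed.

Let leq_resid (u : nat * nat) : u \in ds -> resid l u <= D.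
Proof. exact: leq_bigmax_mem. Qed.

Let rnk_x1 i : (rnk (x1 i) == 0) = (rnk (x i) == 0) && (i != b).
Proof. by rewrite /x1 /fwd /=; case: (eqVneq i b) => //=; rewrite ?andbF ?andbT. Qed.

Let sum_unselected (Q : pred I) (F : I -> nat) :
  \sum_(i | (rnk (x i) == 0) && Q i) F i =
  (if Q b then F b else 0) + \sum_(i | (rnk (x1 i) == 0) && Q i) F i.
Proof.
case Qb: (Q b).
  rewrite (bigD1 b) /=; last by rewrite rnk_b Qb.
  by congr addn; apply: eq_bigl => i; rewrite rnk_x1 andbAC.
apply: eq_bigl => i; rewrite rnk_x1; case: (eqVneq i b) => [->|]; first by rewrite Qb !andbF.
by rewrite andbT.
Qed.

Let load_x1 t : load (listing x1) t =
  (if act (x b) t then initial_mul ds l (x b) * wt (x b) else 0) + load l t.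
Proof.
rewrite !load_listing; case ab: (act (x b) t).
  rewrite (bigD1 b) //= [in RHS](bigD1 b) //= eqxx mul_b add0n; congr addn.
  by apply: eq_bigr => i /andP [_ /negPf ->].
apply: eq_bigr => i ai; rewrite /= ifN //.
by apply: contraTneq ai => ->; rewrite ab.
Qed.

Lemma fwd_inv : inv x1.
Proof.
case: (inv_x) => h1 h2 h3 h4 h5 h6; split=> //.
- by move=> i; rewrite /=; case: (i == b) => //; apply: h3.
- by move=> i; rewrite /=; case: eqP => [-> //|_]; apply: h4.
- have lt j : rnk (x j) < (top_rank l).+1 by rewrite ltnS leq_top_rank.
  move=> i j /=; case: (eqVneq i b) => [->|_]; case: (eqVneq j b) => [->|_] //; last exact: h5.
    by move=> _ E; have := lt j; rewrite -E ltnn.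
  by move=> _ E; have := lt i; rewrite E ltnn.
- move=> i ni; rewrite /= /initial_mul; case: (i == b); last exact: h6.
  by rewrite (negPf ni).
Qed.

Lemma fwd_covers : covers x1 m.
Proof.
case: cov_x => single cov; split=> // u uds.
rewrite /resid load_x1 subn_gt0 => lt.
have lt' : 0 < resid l u by rewrite /resid; lia.
pose s := \sum_(i | (rnk (x1 i) == 0) && act (x i) u.1) m i * wt (x i).
rewrite [leqRHS](_ : _ = s) //.
have := cov u uds lt'; rewrite sum_unselected -/s; case ab: (act (x b) u.1) lt => lt; last first.
  by rewrite /resid !add0n.
have := leq_resid uds; have := single b; rewrite /initial_mul in lt *.
case: (multi (x b)) lt => [lt _|lt /(_ isT) m1] le1 le2.
  have : D <= ceil_div D (wt (x b)) * wt (x b) by rewrite -ceil_divP.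
  by rewrite /D /l in le1 *; rewrite /resid in le1 lt'; lia.
have : m b * wt (x b) <= wt (x b) by rewrite -{2}[wt _]mul1n leq_mul2r m1 orbT.
by rewrite /resid -/l in le2; lia.
Qed.

Lemma weight_fwd (v : I -> nat) :
  e b * weight x v =
  weight x1 v + cst (x b) * \sum_(i | (rnk (x i) == 0) && act (x i) tau) v i * e i.
Proof.
have -> : weight x1 v = \sum_(i | rnk (x i) == 0) v i * cst (x1 i).
  have := sum_unselected predT (fun i => v i * cst (x1 i)).
  rewrite [cst (x1 b)]/= rnk_b eqxx act_b /= subnn muln0 add0n /weight.
  under eq_bigl do rewrite andbT; move=> ->.
  by apply: eq_bigl => i; rewrite andbT.
rewrite /weight !big_distrr /= [X in _ = _ + X]big_mkcondr -big_split /=.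
apply: eq_bigr => i ri; rewrite ri /=.
case ai: (act (x i) tau); last by rewrite addn0 mulnCA [e b * _]mulnC.
rewrite -/l -/(e b) -/(e i) [cst (x b) * (v i * _)]mulnCA -mulnDr subnK.
  by rewrite mulnCA [e b * _]mulnC.
case: (posnP (wt (x i))) => [w0|w0]; last by apply: cheap_b; apply/and4P.
by rewrite /e /eff w0 min0n muln0.
Qed.

Variable y1 : I -> item.
Hypothesis out_y1 : outcome x1 y1.
Let y := bwd y1 b.

Lemma fwd_rank i : i != b -> rnk (y1 i) < rnk (y1 b).
Proof.
have [-> _] : rnk (y1 b) = rnk (x1 b) /\ mul (y1 b) = mul (x1 b).
  by apply: (out_selected out_y1); rewrite /= eqxx.
move=> nb; rewrite [rnk (x1 b)]/= eqxx ltnS.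
case: (posnP (rnk (x1 i))) => r; first by rewrite (out_rnk out_y1 r).
by have [-> _] := out_selected out_y1 r; rewrite /= (negPf nb) leq_top_rank.
Qed.

Let data_y1 i : data (y1 i) = data (x i).
Proof. exact: out_data out_y1 i. Qed.

Let data_y i : data (y i) = data (x i).
Proof. by rewrite /y /bwd; case: (i == b); rewrite /= data_y1. Qed.

Let others t := \sum_(i | act (x i) t && (i != b)) mul (y1 i) * wt (x i).

Let load_y1 t : act (x b) t ->
  load (listing y1) t = mul (y1 b) * wt (x b) + others t.
Proof.
move=> ab; rewrite load_listing (bigD1 b) /= data_y1 //; congr addn.
by apply: eq_big => [i|i _]; rewrite data_y1.
Qed.

Let load_y t : act (x b) t ->
  load (listing y) t = needed ds (listing y1) (y1 b) * wt (x b) + others t.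
Proof.
move=> ab; rewrite load_listing (bigD1 b) /= data_y // {1}/y /bwd eqxx; congr addn.
apply: eq_big => [i|i]; rewrite data_y //.
by rewrite /y /bwd => /andP [_ /negPf ->].
Qed.

Let load_inactive t : act (x b) t = false -> load (listing y) t = load (listing y1) t.
Proof.
move=> ab; rewrite !load_listing; apply: eq_big => [i|i]; rewrite data_y data_y1 // => ai.
rewrite /y /bwd ifN //; by apply: contraTneq ai => ->; rewrite ab.
Qed.

Let needed_ge (u : nat * nat) : u \in ds -> act (x b) u.1 ->
  u.2 - others u.1 <= needed ds (listing y1) (y1 b) * wt (x b).
Proof.
move=> uds ab; rewrite -ceil_divP //.
pose F u := if act (y1 b) u.1 then ceil_div (u.2 - (load (listing y1) u.1
  - mul (y1 b) * wt (y1 b))) (wt (y1 b)) else 0.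
apply: leq_trans (leq_bigmax_mem F uds).
by rewrite /F data_y1 ab load_y1 // addKn.
Qed.

Let needed_le : needed ds (listing y1) (y1 b) <= mul (y1 b).
Proof.
rewrite /needed big_seq; elim/big_ind: _ => //[m' n' h1 h2|u uds]; first by rewrite geq_max h1.
case ab: (act (y1 b) u.1) => //; rewrite data_y1 in ab *.
rewrite ceil_divP // load_y1 // addKn leq_subLR addnC -load_y1 //.
exact: (out_cover out_y1).
Qed.

Let leq_load t : load (listing y) t <= load (listing y1) t.
Proof.
case ab: (act (x b) t); last by rewrite load_inactive.
by rewrite load_y // load_y1 // leq_add2r leq_mul2r needed_le orbT.
Qed.

Lemma bwd_outcome : outcome x y.
Proof.
split.
- exact: data_y.
- move=> i ri; have nb : i != b by apply: contraTneq ri => ->; rewrite rnk_b.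
  have := @out_selected _ _ out_y1 i.
  by rewrite /= (negPf nb) /y /bwd (negPf nb); apply.
- move=> i /eqP ri; rewrite /y /bwd; case: (eqVneq i b) => // nb.
  by apply: (out_rnk out_y1); apply/eqP; rewrite rnk_x1 ri.
- move=> i; rewrite /y /bwd; case: (eqVneq i b) => [->|_] /=; last exact: (out_single out_y1).
  by move=> /(out_single out_y1); apply: leq_trans needed_le.
- move=> u uds; case ab: (act (x b) u.1); last by rewrite load_inactive // (out_cover out_y1).
  by rewrite load_y // addnC -leq_subLR needed_ge.
- move=> i ri; rewrite {1}/y /bwd; case: (eqVneq i b) => [->|nb] /=; last first.
    have r1 : rnk (x1 i) = 0 by apply/eqP; rewrite rnk_x1 ri eqxx.
    case/(out_critical out_y1 r1) => u uds /andP [ai lt]; exists u => //.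
    rewrite data_y -(data_y1 i) ai; apply: leq_ltn_trans lt; exact: leq_load.
  move=> gt0; have [u uds E] := bigmax_attained gt0; exists u => //.
  move: E; rewrite -/(needed ds (listing y1) (y1 b)) data_y data_y1.
  case ab: (act (x b) u.1) => /= E; last by rewrite -E in gt0.
  move: E; rewrite load_y // load_y1 // addKn => E.
  move: gt0; rewrite -/(needed ds (listing y1) (y1 b)).
  case: (needed _ _ _) E => // k E _.
  have : ~~ (ceil_div (u.2 - others u.1) (wt (x b)) <= k) by rewrite E ltnn.
  rewrite ceil_divP // -ltnNge ltn_subRL => lt.
  by rewrite mulSn -addnA [ltnRHS]addnC ltn_add2l addnC.
Qed.

Lemma bwd_weight :
  weight x1 (fun i => mul (y1 i)) <= 4 * weight x1 m ->
  weight x (fun i => mul (y i)) <= 4 * weight x m.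
Proof.
move=> le; rewrite -(leq_pmul2l e_b) mulnCA !weight_fwd mulnDr mulnCA.
apply: leq_add.
  apply: leq_trans le; rewrite leq_eqVlt; apply/orP; left; apply/eqP.
  apply: eq_bigr => i; rewrite rnk_x1 => /andP [_ /negPf nb].
  by rewrite /y /bwd nb.
rewrite leq_mul2l; apply/orP; right; apply: (@leq_trans (4 * D)); last first.
  rewrite leq_mul2l /=.
  have [u uds [Eu Du]] := peakP D_gt0.
  have [_ /(_ u uds)] := cov_x; rewrite Du Eu => /(_ D_gt0) Dle.
  case: (pickP (fun i => [&& (rnk (x i) == 0) && act (x i) tau, 0 < m i & D < wt (x i)])).
    move=> i /and3P [Pi mi Di]; rewrite (bigD1 i) //=; apply: leq_trans (leq_addr _ _).
    by rewrite /e /eff (minn_idPr (ltnW Di)) leq_pmull.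
  move=> none; apply: leq_trans Dle _; apply: leq_sum => i Pi.
  have := none i; rewrite Pi /= => /negbT; rewrite negb_and -!leqNgt leqn0.
  by case/orP => [/eqP -> //|le']; rewrite /e /eff (minn_idPl le').
have out := bwd_outcome.
apply: (charging (lo := fun i => begins (x i)) (hi := fun i => ends (x i))
  (v := fun i => wt (x i)) (mu := fun i => mul (y i)) (U := fun i => rnk (x i) == 0)).
move=> i ri0 ai mui; have ri := eqP ri0.
have [u uds] := out_critical out ri mui; rewrite data_y => /andP [au].
rewrite load_listing (bigID (fun j => rnk (x j) == 0)) /=.
have -> : \sum_(j | act (y j) u.1 && (rnk (x j) != 0)) mul (y j) * wt (y j) = load l u.1.
  rewrite load_listing [RHS](bigID (fun j => rnk (x j) == 0)) /= [X in _ = X + _]big1.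
    apply: eq_big => j; rewrite data_y // -lt0n => /andP [_ rj].
    by have [_ ->] := out_selected out rj.
  by move=> j /andP [_ /eqP rj]; rewrite (inv_mul inv_x rj).
have -> : \sum_(j | act (y j) u.1 && (rnk (x j) == 0)) mul (y j) * wt (y j) =
    \sum_(j | (rnk (x j) == 0) && act (x j) u.1) mul (y j) * wt (x j).
  by apply: eq_big => j; rewrite data_y // andbC.
set S := \sum_(j | _) _ => lt; exists u.1; apply/andP; split; first exact: au.
have : wt (x i) <= S.
  by rewrite /S (bigD1 i) /= ?ri0 //; apply: leq_trans (leq_addr _ _); rewrite leq_pmull.
have := leq_resid uds; rewrite /resid => le1 le2.
suff : S < D + wt (x i) by []; lia.
Qed.

End Round.

Lemma outcome_refl x : inv x -> peak ds (listing x) = 0 -> outcome x x.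
Proof.
move=> ix D0; split=> //; first exact: inv_single.
- move=> u uds; have := leq_bigmax_mem (resid (listing x)) uds.
  by rewrite -/(peak ds (listing x)) D0 leqn0 subn_eq0.
- by move=> i /(inv_mul ix) ->.
Qed.

Lemma local_ratio p x m : inv x -> covers x m ->
  #|[pred i | rnk (x i) == 0]| <= p ->
  exists q y, [/\ q <= p,
    iter q (backward ds) (iter p (forward ds) (listing x)) = listing y,
    outcome x y & weight x (fun i => mul (y i)) <= 4 * weight x m].
Proof.
elim: p x => [|p IH] x ix cov le; case: (posnP (peak ds (listing x))) => [D0|D_gt0].
- exists 0, x; split=> //; first exact: outcome_refl.
  by rewrite /weight big1 // => i /eqP /(inv_mul ix) ->.
- have [b [cb _ _]] := bestP ix D_gt0 cov.
  move: le; rewrite leqn0 => /eqP /card0_eq /(_ b).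
  by rewrite !inE; case/and4P: cb => _ ->.
- exists 0, x; split=> //; last first.
  + by rewrite /weight big1 // => i /eqP /(inv_mul ix) ->.
  + exact: outcome_refl.
  + by rewrite [iter 0 _ _]/= iter_fix // forward_id.
- have [b [cb Eb cheap]] := bestP ix D_gt0 cov.
  have rb : rnk (x b) == 0 by case/and4P: cb.
  have [|q [y1 [le_q E out w1]]] := IH (fwd x b) (fwd_inv ix cb) (fwd_covers ix cov D_gt0 cb).
    move: le; rewrite (cardD1 b) inE rb add1n ltnS; apply: leq_trans.
    apply/subset_leq_card/subsetP => i; rewrite !inE /=.
    by case: (eqVneq i b).
  exists q.+1, (bwd y1 b); split=> //.
  + rewrite iterS iterSr (forward_listing ix Eb) E (@backward_listing _ b) //.
      by have [|-> _] := @out_selected _ _ out b; rewrite /= eqxx.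
    exact: (fwd_rank out).
  + exact: (bwd_outcome cb out).
  + exact: (bwd_weight ix cov D_gt0 cb cheap out w1).
Qed.

Lemma backward_id x : (forall i, rnk (x i) = 0) -> backward ds (listing x) = listing x.
Proof. by move=> r0; rewrite /backward -map_comp; apply: eq_map => i /=; rewrite r0. Qed.

Lemma solveP x m : inv x -> (forall i, rnk (x i) = 0) ->
  (forall i, ~~ multi (x i) -> m i <= 1) ->
  (forall u : nat * nat, u \in ds ->
    u.2 <= \sum_(i | act (x i) u.1) m i * wt (x i)) ->
  exists y, [/\ solve ds (listing x) = listing y,
    forall i, data (y i) = data (x i),
    forall i, ~~ multi (x i) -> mul (y i) <= 1,
    forall u : nat * nat, u \in ds ->
      u.2 <= \sum_(i | act (x i) u.1) mul (y i) * wt (x i) &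
    \sum_i mul (y i) * cst (x i) <= 4 * \sum_i m i * cst (x i)].
Proof.
move=> ix r0 single cov; set n := size (listing x).
have cx : covers x m.
  split=> // u /cov le _; apply: leq_trans (leq_subr _ _) (leq_trans le _).
  by apply: eq_leq; apply: eq_bigl => i; rewrite r0.
have [|q [y [le_q E out w]]] := local_ratio (p := n) ix cx.
  by rewrite /n size_map -cardE; apply: max_card.
have ry i : rnk (y i) = 0 by apply: out_rnk out _ (r0 i).
exists y; split.
- rewrite /solve -/n -{1}(subnK le_q) iterD E.
  by rewrite iter_fix // backward_id.
- exact: out_data out.
- by move=> i; rewrite -(out_data out); apply: out_single out i.
- move=> u /(out_cover out); rewrite load_listing.
  by under eq_big => [i|i _] do [rewrite (out_data out)|rewrite (out_data out)].
- by move: w; rewrite /weight; under eq_bigl do rewrite r0; under [in leqRHS]eq_bigl do rewrite r0.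
Qed.

End LocalRatio.

(** * Running time *)

Ltac ptime_leaf :=
  first
  [ assumption
  | apply ptime_const
  | exact (ptime_var _ _)
  | exact (ptime_weak _ (ptime_var _ _))
  | match goal with
    | H : ptime ?e _ |- ptime (ctx ?e ?c) _ => exact (ptime_weak c H)
    | H : ptime ?e _ |- ptime (ctx (ctx ?e ?c) ?d) _ =>
        exact (ptime_weak d (ptime_weak c H))
    end ].

Ltac ptime_step :=
  lazymatch goal with
  | |- ptime ?e (fun a => Nat (addn (@?f a) (@?g a))) => apply (@ptime_add _ e f g)
  | |- ptime ?e (fun a => Nat (subn (@?f a) (@?g a))) => apply (@ptime_sub _ e f g)
  | |- ptime ?e (fun a => Nat (muln (@?f a) (@?g a))) => apply (@ptime_mul _ e f g)
  | |- ptime ?e (fun a => Nat (divn (@?f a) (@?g a))) => apply (@ptime_div _ e f g)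
  | |- ptime ?e (fun a => Nat (minn (@?f a) (@?g a))) => apply (@ptime_min _ e f g)
  | |- ptime ?e (fun a => Nat (S (@?f a))) => apply (@ptime_succ _ e f)
  | |- ptime _ (fun a => Nat (if _ then _ else _)) => apply ptime_ifn
  | |- ptime ?e (fun a => Nat (nat_of_bool (leq (@?f a) (@?g a)))) =>
      apply (@ptime_leq _ e f g)
  | |- ptime ?e (fun a => Nat (nat_of_bool (eq_op (@?f a) (@?g a)))) =>
      apply (@ptime_eqn _ e f g)
  | |- ptime ?e (fun a => Nat (nat_of_bool (andb (@?f a) (@?g a)))) =>
      apply (@ptime_and _ e f g)
  | |- ptime ?e (fun a => Nat (nat_of_bool (implb (@?f a) (@?g a)))) =>
      apply (@ptime_imply _ e f g)
  | |- ptime ?e (fun a => Pair (@?f a) (@?g a)) => apply (@ptime_pair _ e f g)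
  end; cbv beta.

Ltac ptime_auto := cbv beta; repeat ptime_step; try ptime_leaf.

Definition enc_slot (u : nat * nat) : tree := Pair (Nat u.1) (Nat u.2).

Definition enc_static (x : static) : tree :=
  Pair (Nat (uid x)) (Pair (Nat (begins x)) (Pair (Nat (ends x))
    (Pair (Nat (wt x)) (Nat (multi x))))).

Definition enc_item (x : item) : tree :=
  Pair (enc_static x) (Pair (Nat (cst x)) (Pair (Nat (rnk x)) (Nat (mul x)))).

Section Fields.
Variables (A : Type) (e : A -> tree) (x : A -> item) (u : A -> nat * nat).
Hypothesis Hx : ptime e (fun a => enc_item (x a)).
Hypothesis Hu : ptime e (fun a => enc_slot (u a)).

Lemma ptime_fst : ptime e (fun a => Nat (u a).1).
Proof. exact: ptime_left Hu. Qed.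
Lemma ptime_snd : ptime e (fun a => Nat (u a).2).
Proof. exact: ptime_right Hu. Qed.
Lemma ptime_data : ptime e (fun a => enc_static (x a)).
Proof. exact: ptime_left Hx. Qed.
Lemma ptime_uid : ptime e (fun a => Nat (uid (x a))).
Proof. exact: ptime_left ptime_data. Qed.
Lemma ptime_begins : ptime e (fun a => Nat (begins (x a))).
Proof. exact/ptime_left/ptime_right/ptime_data. Qed.
Lemma ptime_ends : ptime e (fun a => Nat (ends (x a))).
Proof. exact/ptime_left/ptime_right/ptime_right/ptime_data. Qed.
Lemma ptime_wt : ptime e (fun a => Nat (wt (x a))).
Proof. exact/ptime_left/ptime_right/ptime_right/ptime_right/ptime_data. Qed.
Lemma ptime_multi : ptime e (fun a => Nat (multi (x a))).
Proof. exact/ptime_right/ptime_right/ptime_right/ptime_right/ptime_data. Qed.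
Lemma ptime_cst : ptime e (fun a => Nat (cst (x a))).
Proof. exact/ptime_left/ptime_right/Hx. Qed.
Lemma ptime_rnk : ptime e (fun a => Nat (rnk (x a))).
Proof. exact/ptime_left/ptime_right/ptime_right/Hx. Qed.
Lemma ptime_mult : ptime e (fun a => Nat (mul (x a))).
Proof. exact/ptime_right/ptime_right/ptime_right/Hx. Qed.

Lemma ptime_act (t : A -> nat) :
  ptime e (fun a => Nat (t a)) -> ptime e (fun a => Nat (act (x a) (t a))).
Proof.
move=> Ht; have := ptime_begins; have := ptime_ends; rewrite /act => *; ptime_auto.
Qed.

End Fields.

Ltac ptime_field :=
  lazymatch goal with
  | |- ptime ?e (fun a => Nat (fst (@?u a))) => apply (@ptime_fst _ e u)
  | |- ptime ?e (fun a => Nat (snd (@?u a))) => apply (@ptime_snd _ e u)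
  | |- ptime ?e (fun a => enc_static (data (@?x a))) => apply (@ptime_data _ e x)
  | |- ptime ?e (fun a => Nat (uid (data (@?x a)))) => apply (@ptime_uid _ e x)
  | |- ptime ?e (fun a => Nat (wt (data (@?x a)))) => apply (@ptime_wt _ e x)
  | |- ptime ?e (fun a => Nat (nat_of_bool (multi (data (@?x a))))) =>
      apply (@ptime_multi _ e x)
  | |- ptime ?e (fun a => Nat (cst (@?x a))) => apply (@ptime_cst _ e x)
  | |- ptime ?e (fun a => Nat (rnk (@?x a))) => apply (@ptime_rnk _ e x)
  | |- ptime ?e (fun a => Nat (mul (@?x a))) => apply (@ptime_mult _ e x)
  | |- ptime ?e (fun a => Nat (nat_of_bool (act (data (@?x a)) (@?t a)))) =>
      refine (@ptime_act _ e x _ t _)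
  end; cbv beta.

Ltac ptime_expr := cbv beta; repeat first [ptime_step | ptime_field]; try ptime_leaf.

Section Rounds.
Variables (A : Type) (e : A -> tree) (l : A -> seq item).
Hypothesis Hl : ptime e (fun a => enc_list enc_item (l a)).

Lemma ptime_load (t : A -> nat) : ptime e (fun a => Nat (t a)) ->
  ptime e (fun a => Nat (load (l a) (t a))).
Proof. by move=> Ht; apply: (ptime_sum Hl); ptime_expr. Qed.

Lemma ptime_resid (u : A -> nat * nat) : ptime e (fun a => enc_slot (u a)) ->
  ptime e (fun a => Nat (resid (l a) (u a))).
Proof.
by move=> Hu; rewrite /resid; ptime_expr; apply: ptime_load; ptime_expr.
Qed.

Lemma ptime_top_rank : ptime e (fun a => Nat (top_rank (l a))).
Proof. by apply: (ptime_bigmax Hl); ptime_expr. Qed.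

Lemma ptime_ceil_div (f g : A -> nat) :
  ptime e (fun a => Nat (f a)) -> ptime e (fun a => Nat (g a)) ->
  ptime e (fun a => Nat (ceil_div (f a) (g a))).
Proof. by move=> Hf Hg; rewrite /ceil_div; ptime_expr. Qed.

End Rounds.

Section Peaks.
Variables (A : Type) (e : A -> tree) (l : A -> seq item) (ds : A -> seq (nat * nat)).
Hypothesis Hl : ptime e (fun a => enc_list enc_item (l a)).
Hypothesis Hds : ptime e (fun a => enc_list enc_slot (ds a)).

Lemma ptime_peak : ptime e (fun a => Nat (peak (ds a) (l a))).
Proof. by apply: (ptime_bigmax Hds); apply: ptime_resid; ptime_leaf. Qed.

Lemma ptime_peak_time : ptime e (fun a => Nat (peak_time (ds a) (l a))).
Proof.
have := ptime_peak => Hp; apply: (ptime_bigmax Hds); ptime_expr.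
by apply: ptime_resid; ptime_leaf.
Qed.

Variable x : A -> item.
Hypothesis Hx : ptime e (fun a => enc_item (x a)).

Lemma ptime_eff : ptime e (fun a => Nat (eff (ds a) (l a) (x a))).
Proof. by have := ptime_peak => Hp; rewrite /eff; ptime_expr. Qed.

Lemma ptime_cand : ptime e (fun a => Nat (cand (ds a) (l a) (x a))).
Proof.
have := ptime_peak => Hp; have := ptime_peak_time => Ht.
by rewrite /cand; ptime_expr.
Qed.

Lemma ptime_initial_mul : ptime e (fun a => Nat (initial_mul (ds a) (l a) (x a))).
Proof.
have := ptime_peak => Hp; rewrite /initial_mul; ptime_expr.
by apply: ptime_ceil_div; ptime_expr.
Qed.

Lemma ptime_needed : ptime e (fun a => Nat (needed (ds a) (l a) (x a))).
Proof.
apply: (ptime_bigmax Hds); ptime_expr; apply: ptime_ceil_div; ptime_expr.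
by apply: ptime_load; ptime_expr.
Qed.

End Peaks.

Lemma ptime_cheapest (A : Type) (e : A -> tree) (l : A -> seq item)
    (ds : A -> seq (nat * nat)) (x : A -> item) :
  ptime e (fun a => enc_list enc_item (l a)) ->
  ptime e (fun a => enc_list enc_slot (ds a)) ->
  ptime e (fun a => enc_item (x a)) ->
  ptime e (fun a => Nat (cheapest (ds a) (l a) (x a))).
Proof.
move=> Hl Hds Hx; apply: (ptime_all Hl); ptime_expr.
- by apply: ptime_cand; ptime_leaf.
- by apply: ptime_eff; ptime_leaf.
- by apply: ptime_eff; ptime_leaf.
Qed.

Section Step.
Variables (A : Type) (e : A -> tree) (l : A -> seq item) (ds : A -> seq (nat * nat)).
Hypothesis Hl : ptime e (fun a => enc_list enc_item (l a)).
Hypothesis Hds : ptime e (fun a => enc_list enc_slot (ds a)).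

Lemma ptime_best : ptime e (fun a => Nat (best (ds a) (l a))).
Proof.
apply: (ptime_bigmax Hl); ptime_expr.
- by apply: ptime_cand; ptime_leaf.
- by apply: ptime_cheapest; ptime_leaf.
Qed.

Lemma ptime_best_cost : ptime e (fun a => Nat (best_cost (ds a) (l a))).
Proof. by have := ptime_best => Hb; apply: (ptime_bigmax Hl); ptime_expr. Qed.

Lemma ptime_best_eff : ptime e (fun a => Nat (best_eff (ds a) (l a))).
Proof.
have := ptime_best => Hb; apply: (ptime_bigmax Hl); ptime_expr.
by apply: ptime_eff; ptime_leaf.
Qed.

Lemma ptime_forward : ptime e (fun a => enc_list enc_item (forward (ds a) (l a))).
Proof.
have Hb := ptime_best; have Hc := ptime_best_cost; have He := ptime_best_eff.
have Hr := ptime_top_rank Hl; have Ht := ptime_peak_time Hl Hds.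
suff H : ptime e (fun a => enc_list enc_item
    (map (forward_item (ds a) (l a)) (l a))).
  apply: ptime_eq (ptime_if (ptime_eqn Hb (ptime_const e 0)) Hl H) => a.
  by rewrite /forward; case: eqP.
apply: (ptime_map Hl); rewrite /forward_item /enc_item /= /new_cost; ptime_expr.
- by apply: ptime_eff; ptime_leaf.
- by apply: ptime_initial_mul; ptime_leaf.
Qed.

Lemma ptime_backward : ptime e (fun a => enc_list enc_item (backward (ds a) (l a))).
Proof.
have Hr := ptime_top_rank Hl.
apply: (ptime_map Hl).
pose b (z : A * item) := (0 < rnk z.2) && (rnk z.2 == top_rank (l z.1)).
pose f (z : A * item) := enc_item (Item z.2 (cst z.2) 0 (needed (ds z.1) (l z.1) z.2)).
apply: (@ptime_eq _ _ (fun z => if b z then f z else enc_item z.2)).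
  by move=> z; rewrite /b; case: ifP.
apply: ptime_if; rewrite /b ?/f /enc_item /=; ptime_expr.
by apply: ptime_needed; ptime_leaf.
Qed.

End Step.

(** * Growth of the numbers *)

Definition fields (x : item) : seq nat :=
  [:: uid x; begins x; ends x; wt x; cst x; rnk x; mul x].

Definition small (B : nat) (l : seq item) : bool :=
  all (fun x => all (fun k => k < B) (fields x)) l.

Lemma bigmax_ltn (C : Type) (P : pred C) (F : C -> nat) (B : nat) (s : seq C) :
  0 < B -> all P s -> (forall x, P x -> F x < B) -> \max_(x <- s) F x < B.
Proof.
move=> B0 + H; elim: s => [|x s IH]; first by rewrite big_nil.
by move=> /andP [/H Px /IH]; rewrite big_cons gtn_max Px.
Qed.

Lemma vsize_item b x : all (fun k => k < 2 ^ b) (fields x) -> vsize (enc_item x) <= 7 * b.+1 + 8.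
Proof.
move=> /= /and5P [h1 h2 h3 h4 /and4P [h5 h6 h7 _]].
have H k : k < 2 ^ b -> nbits k <= b.+1.
  by move=> lt; apply: nbits_leq => //; apply: leq_trans lt _; rewrite leq_exp2l.
move: (H _ h1) (H _ h2) (H _ h3) (H _ h4) (H _ h5) (H _ h6) (H _ h7).
by rewrite nbits_bool; lia.
Qed.

Lemma vsize_items b l : small (2 ^ b) l ->
  vsize (enc_list enc_item l) <= size l * (7 * b.+1 + 9) + 1.
Proof.
rewrite /enc_list; elim: l => //= x l IH /andP [/vsize_item /= h1 /IH h2].
by rewrite mulSn; lia.
Qed.

Lemma small_enc l : small (2 ^ vsize (enc_list enc_item l)) l.
Proof.
suff H b : vsize (enc_list enc_item l) <= b -> small (2 ^ b) l by apply: H.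
rewrite /enc_list; elim: l => //= x l IH le; apply/andP; split; last by apply: IH; lia.
have H k : nbits k <= b -> k < 2 ^ b.
  by move=> le'; apply: leq_trans (ltn_nbits k) _; rewrite leq_exp2l.
by rewrite !H //; lia.
Qed.

Section Growth.
Variables (ds : seq (nat * nat)) (K : nat).
Hypothesis K_gt1 : 1 < K.
Hypothesis small_ds : all (fun u : nat * nat => u.2 < K) ds.

Lemma peak_ltn l : peak ds l < K.
Proof.
apply: (bigmax_ltn _ small_ds) => [|u lt]; first exact: ltnW.
by apply: leq_ltn_trans lt; rewrite leq_subr.
Qed.

Lemma needed_ltn l x : needed ds l x < K.
Proof.
apply: (bigmax_ltn _ small_ds) => [|u lt]; first exact: ltnW.
case: ifP => _; last exact: ltnW.
by apply: leq_ltn_trans (leq_ceil_div _ _) (leq_ltn_trans (leq_subr _ _) lt).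
Qed.

Lemma small_forward B l : 1 < B -> small B l -> small (B * K) (forward ds l).
Proof.
move=> B1 sm; have le : B <= B * K by rewrite leq_pmulr // ltnW.
have KB : K <= B * K by rewrite leq_pmull // ltnW.
have mono k : k < B -> k < B * K by move=> lt; apply: leq_trans lt le.
rewrite /forward; case: ifP => _.
  apply: sub_all sm => x; apply: sub_all => k; exact: mono.
have top : (top_rank l).+1 < B * K.
  have : top_rank l < B.
    apply: (bigmax_ltn _ sm) => [|x]; first exact: ltnW.
    by move=> /= /and5P [_ _ _ _ /and4P []].
  by move=> lt; apply: leq_ltn_trans lt _; rewrite ltn_Pmulr // ltnW.
have eff_lt : best_eff ds l < K.
  apply: (bigmax_ltn (P := predT)) => [||x _]; [exact: ltnW|exact: all_predT|].
  case: ifP => _; last exact: ltnW.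
  by apply: leq_ltn_trans (geq_minr _ _) (peak_ltn l).
rewrite /small all_map; apply: sub_all sm => x /= /and5P [h1 h2 h3 h4 /and4P [h5 h6 h7 _]].
have cost_lt : cst x * best_eff ds l < B * K by apply: ltn_mul.
rewrite (mono _ h1) (mono _ h2) (mono _ h3) (mono _ h4) andbT /=; apply/and3P; split.
- rewrite /new_cost; case: ifP => _ //.
  by apply: leq_ltn_trans (leq_subr _ _) cost_lt.
- by case: ifP => _ //; apply: mono.
- case: ifP => _; last exact: mono.
  rewrite /initial_mul; case: ifP => _; last by apply: leq_trans KB.
  by apply: leq_ltn_trans (leq_ceil_div _ _) (leq_trans (peak_ltn l) KB).
Qed.

Lemma small_backward B l : K <= B -> small B l -> small B (backward ds l).
Proof.
move=> KB sm; rewrite /small all_map; apply: sub_all sm => x /=.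
case: ifP => _ //= /and5P [-> -> -> -> /and4P [-> h6 h7 _]] /=.
by rewrite (leq_trans (needed_ltn l x) KB) (leq_trans _ h6).
Qed.

End Growth.

Lemma size_forward ds l : size (forward ds l) = size l.
Proof. by rewrite /forward; case: ifP => // _; rewrite size_map. Qed.

Lemma size_iter (A : Type) (f : seq A -> seq A) n s :
  (forall s, size (f s) = size s) -> size (iter n f s) = size s.
Proof. by move=> H; elim: n => //= n <-. Qed.

Lemma small_slots ds :
  all (fun u : nat * nat => u.2 < 2 ^ vsize (enc_list enc_slot ds)) ds.
Proof.
suff H b : vsize (enc_list enc_slot ds) <= b ->
    all (fun u : nat * nat => u.2 < 2 ^ b) ds by apply: H.
rewrite /enc_list; elim: ds => //= u ds IH le; apply/andP; split; last by apply: IH; lia.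
by apply: leq_trans (ltn_nbits u.2) _; rewrite leq_exp2l //; lia.
Qed.

Section Solve.
Variables (A : Type) (e : A -> tree) (l : A -> seq item) (ds : A -> seq (nat * nat)).
Hypothesis Hl : ptime e (fun a => enc_list enc_item (l a)).
Hypothesis Hds : ptime e (fun a => enc_list enc_slot (ds a)).

Let N a := vsize (enc_list enc_item (l a)) + vsize (enc_list enc_slot (ds a)).

Let N_poly : polybound (fun a => vsize (e a)) N.
Proof. exact: polybound_add (polybound_list Hl) (polybound_list Hds). Qed.

Let tau a := N a * (7 * (N a * (N a + 1)).+1 + 9) + 1.

Let tau_poly : polybound (fun a => vsize (e a)) tau.
Proof.
have c := polybound_const (fun a => vsize (e a)).
apply: (polybound_add (polybound_mul N_poly _) (c 1)).
apply: (polybound_add (polybound_mul (c 7) _) (c 9)).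
apply: polybound_mono (polybound_add (polybound_mul N_poly (polybound_add N_poly (c 1))) (c 1)) _.
by move=> a; rewrite [ltnRHS]addn1.
Qed.

Let bound a i k : size k = size (l a) -> i <= size (l a) -> small (2 ^ (N a * i.+1)) k ->
  vsize (enc_list enc_item k) <= tau a.
Proof.
move=> Es le sm; apply: leq_trans (vsize_items sm) _.
have leN : size (l a) <= N a by apply: leq_trans (size_enc_list _ _) (leq_addr _ _).
rewrite /tau leq_add2r Es leq_mul // leq_add2r leq_mul2l ltnS leq_mul2l addn1 ltnS.
by rewrite (leq_trans le leN) orbT.
Qed.

Let N_gt0 a : 0 < N a.
Proof. by rewrite addn_gt0 vsize_gt0. Qed.

Let gt1 a : 1 < 2 ^ N a.
Proof. by rewrite -(expn0 2) ltn_exp2l. Qed.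

Let small_ds a : all (fun u : nat * nat => u.2 < 2 ^ N a) (ds a).
Proof.
apply: sub_all (small_slots (ds a)) => u lt; apply: leq_trans lt _.
by rewrite leq_exp2l // leq_addl.
Qed.

Let small_l a : small (2 ^ N a) (l a).
Proof.
apply: sub_all (small_enc (l a)) => x; apply: sub_all => k lt; apply: leq_trans lt _.
by rewrite leq_exp2l // leq_addr.
Qed.

Lemma ptime_iter_forward :
  ptime e (fun a => enc_list enc_item (iter (size (l a)) (forward (ds a)) (l a))).
Proof.
apply: (ptime_iter (tau := tau) Hl Hl _ tau_poly).
  by apply: ptime_forward; ptime_leaf.
move=> a i le; apply: (bound (i := i)) => //.
  by apply: size_iter => s; apply: size_forward.
elim: i {le} => [|i IH]; first by rewrite muln1.
rewrite mulnS addnC expnD; apply: small_forward => //.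
by rewrite -(expn0 2) ltn_exp2l // muln_gt0 N_gt0.
Qed.

Lemma ptime_iter_backward (B : Type) (c : B -> tree) (cnt : A -> seq B) :
  ptime e (fun a => enc_list c (cnt a)) ->
  ptime e (fun a => enc_list enc_item (iter (size (cnt a)) (backward (ds a)) (l a))).
Proof.
move=> Hc; apply: (ptime_iter (tau := tau) Hc Hl _ tau_poly).
  by apply: ptime_backward; ptime_leaf.
move=> a i _; apply: (bound (i := 0)) => //.
  by apply: size_iter => s; rewrite size_map.
rewrite muln1; elim: i => [|i IH] //=.
by apply: (small_backward (gt1 a) (small_ds a)).
Qed.

End Solve.

Lemma ptime_solve (A : Type) (e : A -> tree) (l : A -> seq item) (ds : A -> seq (nat * nat)) :
  ptime e (fun a => enc_list enc_item (l a)) ->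
  ptime e (fun a => enc_list enc_slot (ds a)) ->
  ptime e (fun a => enc_list enc_item (solve (ds a) (l a))).
Proof.
move=> Hl Hds.
exact: (ptime_iter_backward (ptime_iter_forward Hl Hds) Hds Hl).
Qed.

(** * Clearing denominators *)

Definition common_denom (f : resource -> rat) (I : instance) : nat :=
  \prod_(r <- resources I) `|denq (f r)|.

Definition scaled (P : nat) (q : rat) : nat := `|numq q| * P %/ `|denq q|.

Definition is_multi (r : resource) : bool := if kind r is Mtype then true else false.

Definition slots (I : instance) : seq (nat * nat) :=
  map_suffix (fun d tl => (horizon I - size tl, common_denom capacity I * d)) (demands I).

Definition items (I : instance) : seq item :=
  map_suffix (fun r tl =>
    Item (Static (size (resources I) - size tl) (start r) (finish r)
            (scaled (common_denom capacity I) (capacity r)) (is_multi r))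
         (scaled (common_denom rcost I) (rcost r)) 0 0) (resources I).

Definition cover (I : instance) : multiset := map mul (solve (slots I) (items I)).

Section CoverTime.

Let demands_ptime : ptime encode_instance (fun I => enc_list Nat (demands I)).
Proof. exact/ptime_left/ptime_id. Qed.

Let resources_ptime : ptime encode_instance (fun I => enc_list encode_resource (resources I)).
Proof. exact/ptime_right/ptime_id. Qed.

Lemma ptime_size (A B : Type) (e : A -> tree) (c : B -> tree) (l : A -> seq B) :
  ptime e (fun a => enc_list c (l a)) -> ptime e (fun a => Nat (size (l a))).
Proof.
move=> H; apply: ptime_eq (ptime_sum (F := fun _ _ => 1) H (ptime_const _ 1)) => a.
by rewrite sum1_size.
Qed.

Section ResourceFields.
Variables (A : Type) (e : A -> tree) (r : A -> resource).
Hypothesis Hr : ptime e (fun a => encode_resource (r a)).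

Lemma ptime_start : ptime e (fun a => Nat (start (r a))).
Proof. exact: ptime_left Hr. Qed.
Lemma ptime_finish : ptime e (fun a => Nat (finish (r a))).
Proof. exact/ptime_left/ptime_right/Hr. Qed.
Lemma ptime_capacity : ptime e (fun a => encode_rat (capacity (r a))).
Proof. exact/ptime_left/ptime_right/ptime_right/Hr. Qed.
Lemma ptime_rcost : ptime e (fun a => encode_rat (rcost (r a))).
Proof. exact/ptime_left/ptime_right/ptime_right/ptime_right/Hr. Qed.
Lemma ptime_is_multi : ptime e (fun a => Nat (is_multi (r a))).
Proof.
have H : ptime e (fun a => Nat (if kind (r a) is Mtype then 1 else 0)).
  exact/ptime_left/ptime_right/ptime_right/ptime_right/ptime_right/Hr.
by apply: ptime_eq H => a; rewrite /is_multi; case: (kind _).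
Qed.

End ResourceFields.

Lemma ptime_common_denom (f : resource -> rat) :
  (forall (A : Type) (e : A -> tree) (r : A -> resource),
    ptime e (fun a => encode_resource (r a)) -> ptime e (fun a => encode_rat (f (r a)))) ->
  ptime encode_instance (fun I => Nat (common_denom f I)).
Proof.
move=> Hf; apply: (ptime_prod resources_ptime).
exact/ptime_right/Hf/ptime_var.
Qed.

Lemma ptime_scaled (A : Type) (e : A -> tree) (P : A -> nat) (q : A -> rat) :
  ptime e (fun a => Nat (P a)) -> ptime e (fun a => encode_rat (q a)) ->
  ptime e (fun a => Nat (scaled (P a) (q a))).
Proof.
move=> HP Hq; have Hn := ptime_left Hq; have Hd := ptime_right Hq.
by rewrite /scaled; ptime_expr.
Qed.

Lemma ptime_slots : ptime encode_instance (fun I => enc_list enc_slot (slots I)).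
Proof.
have Hd := ptime_common_denom ptime_capacity.
have Hh := ptime_size demands_ptime.
apply: (ptime_map_suffix demands_ptime); rewrite /enc_slot /=; ptime_expr.
- apply: (ptime_size (c := Nat)); exact/ptime_right/ptime_var.
- exact/ptime_left/ptime_var.
Qed.

Lemma ptime_items : ptime encode_instance (fun I => enc_list enc_item (items I)).
Proof.
have Hw := ptime_common_denom ptime_capacity.
have Hc := ptime_common_denom ptime_rcost.
have Hn := ptime_size resources_ptime.
apply: (ptime_map_suffix resources_ptime).
have Hr : ptime (ctx encode_instance (enc_suffix encode_resource))
    (fun z => encode_resource z.2.1).
  exact/ptime_left/ptime_var.
rewrite /enc_item /enc_static /=; ptime_expr.
- apply: (ptime_size (c := encode_resource)); exact/ptime_right/ptime_var.
- exact: ptime_start.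
- exact: ptime_finish.
- apply: ptime_scaled; [ptime_leaf | exact: ptime_capacity].
- exact: ptime_is_multi.
- apply: ptime_scaled; [ptime_leaf | exact: ptime_rcost].
Qed.

Lemma ptime_cover : ptime encode_instance (fun I => encode_multiset (cover I)).
Proof.
have H := ptime_solve ptime_items ptime_slots.
apply: (ptime_map (d := Nat) H); ptime_expr.
Qed.

End CoverTime.

Lemma common_denom_gt0 f I : 0 < common_denom f I.
Proof. by apply: prodn_gt0 => r; rewrite absz_gt0 denq_neq0. Qed.

Lemma scaledP (P : nat) (q : rat) : (0 <= q)%R -> `|denq q| %| P ->
  ((scaled P q)%:R = P%:R * q :> rat)%R.
Proof.
move=> q0 /dvdnP [k ->].
have d0 : 0 < `|denq q| by rewrite absz_gt0 denq_neq0.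
have En : (`|numq q|%:R = q * `|denq q|%:R :> rat)%R.
  rewrite !pmulrn gez0_abs ?numq_ge0 // absz_denq; exact: numqE.
rewrite /scaled mulnA mulnK // natrM En natrM.
by rewrite mulrC mulrA mulrAC.
Qed.

Section Correctness.
Variable I : instance.
Hypothesis wf : wf_instance I.

Let n := size (resources I).
Let r0 := Resource 0 0 0%R 0%R Stype.
Let r (i : nat) : resource := nth r0 (resources I) i.
Let P := common_denom capacity I.
Let Q := common_denom rcost I.

Let x (i : 'I_n) : item :=
  Item (Static i.+1 (start (r i)) (finish (r i)) (scaled P (capacity (r i)))
          (is_multi (r i)))
       (scaled Q (rcost (r i))) 0 0.

Lemma map_suffix_nth (B C : Type) (b : B) (f : B -> seq B -> C) s :
  map_suffix f s = [seq f (nth b s i) (drop i.+1 s) | i <- iota 0 (size s)].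
Proof.
elim: s => //= a s IH; rewrite drop0 IH; congr cons.
by rewrite -[1]/(1 + 0) iotaDl -map_comp.
Qed.

Let items_listing : items I = listing x.
Proof.
rewrite /items (map_suffix_nth r0) /listing -val_enum_ord -map_comp.
apply: eq_map => i /=; rewrite /x size_drop -/n subKn //.
Qed.

Let mem_slots (u : nat * nat) : u \in slots I ->
  exists2 t, 1 <= t <= horizon I & u = (t, P * demand I t).
Proof.
rewrite /slots (map_suffix_nth 0) => /mapP [j]; rewrite mem_iota add0n => /= lt ->.
by exists j.+1 => //; rewrite size_drop -/(horizon I) subKn.
Qed.

Let slots_mem t : 1 <= t <= horizon I -> (t, P * demand I t) \in slots I.
Proof.
case: t => // j lt; rewrite /slots (map_suffix_nth 0); apply/mapP; exists j.
  by rewrite mem_iota.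
by rewrite size_drop -/(horizon I) subKn.
Qed.

Let wf_r (i : 'I_n) : (0 <= capacity (r i))%R /\ (0 <= rcost (r i))%R.
Proof.
have /(all_nthP r0) /(_ i (ltn_ord i)) := wf.
by case/and5P.
Qed.

Let dvd_denom f (i : 'I_n) : `|denq (f (r i))| %| common_denom f I.
Proof.
rewrite /common_denom (big_nth r0) big_mkord (bigD1 i) //=.
exact: dvdn_mulr.
Qed.

Let sum_zip (S : multiset) (p : resource -> bool) (f : resource -> rat) :
  size S = n ->
  (\sum_(z <- zip (resources I) S | p z.1) z.2%:R * f z.1 =
   \sum_(i < n | p (r i)) (nth 0%N S i)%:R * f (r i))%R.
Proof.
move=> ES; rewrite (big_nth (r0, 0)) size_zip ES minnn big_mkord.
by apply: eq_big => i; rewrite nth_zip.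
Qed.

Let capacity_scaled (S : multiset) t : size S = n ->
  (P%:R * capacity_at I S t =
   (\sum_(i < n | act (x i) t) nth 0%N S i * wt (x i))%N%:R :> rat)%R.
Proof.
move=> ES; rewrite /capacity_at (sum_zip (active^~ t)) // big_distrr natr_sum /=.
apply: eq_bigr => i _; have [h _] := wf_r i.
by rewrite natrM scaledP ?dvd_denom // mulrCA.
Qed.

Let cost_scaled (S : multiset) : size S = n ->
  (Q%:R * cost I S = (\sum_(i < n) nth 0%N S i * cst (x i))%N%:R :> rat)%R.
Proof.
move=> ES; rewrite /cost (sum_zip xpredT) // big_distrr natr_sum /=.
apply: eq_bigr => i _; have [_ h] := wf_r i.
by rewrite natrM scaledP ?dvd_denom // mulrCA.
Qed.

Let feasibleP (S : multiset) : feasible I S <->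
  [/\ size S = n, forall i : 'I_n, ~~ multi (x i) -> nth 0 S i <= 1 &
    forall u : nat * nat, u \in slots I ->
      u.2 <= \sum_(i | act (x i) u.1) nth 0 S i * wt (x i)].
Proof.
have covP t : size S = n -> ((demand I t)%:R <= capacity_at I S t)%R =
    (P * demand I t <= \sum_(i | act (x i) t) nth 0 S i * wt (x i)).
  move=> ES; rewrite -(ler_nat rat) -capacity_scaled // natrM ler_pM2l //.
  by rewrite ltr0n common_denom_gt0.
have validP : size S = n -> reflect (forall i : 'I_n, ~~ multi (x i) -> nth 0 S i <= 1)
    (all (fun z : resource * nat => if kind z.1 is Stype then z.2 <= 1 else true)
      (zip (resources I) S)).
  move=> ES; apply: (iffP (all_nthP (r0, 0))) => H i.
    have := H i; rewrite size_zip ES minnn nth_zip // => /(_ (ltn_ord i)) /=.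
    by rewrite /is_multi -/(r i); case: (kind _).
  rewrite size_zip ES minnn nth_zip // => lt /=.
  have := H (Ordinal lt); rewrite /= /is_multi /r; case: (kind _) => //; exact.
split.
- move=> [[ES val] cov]; split=> //; first exact/validP.
  by move=> u /mem_slots [t tT ->] /=; rewrite -covP // cov.
- move=> [ES val cov]; split; first by split=> //; apply/validP.
  by move=> t tT; rewrite covP //; apply: (cov (t, _)); apply: slots_mem.
Qed.

Lemma cover_approx (S : multiset) : feasible I S ->
  feasible I (cover I) /\ (cost I (cover I) <= 4%:R * cost I S)%R.
Proof.
case/feasibleP => ES single cov.
have ix : inv x by split=> // i j [] /ord_inj.
have [y [E Ey single_y cov_y cost_y]] :=
  solveP (m := fun i : 'I_n => nth 0 S i) ix (fun _ => erefl) single cov.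
have Ec : cover I = [seq mul (y i) | i <- enum 'I_n].
  by rewrite /cover items_listing E /listing -map_comp.
have size_c : size (cover I) = n by rewrite Ec size_map size_enum_ord.
have nth_c (i : 'I_n) : nth 0 (cover I) i = mul (y i).
  by rewrite Ec (nth_map i) ?size_enum_ord // nth_ord_enum.
split.
- apply/feasibleP; split=> // [i|u /cov_y].
    by rewrite nth_c; apply: single_y.
  by under eq_bigr do rewrite -nth_c.
- have Q0 : (0 < Q%:R :> rat)%R by rewrite ltr0n common_denom_gt0.
  rewrite -(ler_pM2l Q0) mulrCA !cost_scaled // -natrM ler_nat.
  by under eq_bigr do rewrite nth_c.
Qed.

End Correctness.

Theorem theorem7 : exists A : prog, approximation_algorithm 4%:R%R A.
Proof.
have [p [tau [run [c time] _]]] := ptime_cover; exists p, (3 ^ c), c => I wf.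
have [t le ex] := run I; exists (encode_multiset (cover I)), t; split=> //.
- apply: leq_trans le (leq_trans (time I) _) => /=.
  apply: leq_trans (leq_addr _ _); rewrite -expnMn.
  case: (c) => // k; rewrite leq_exp2r //.
  by have := vsize_gt0 (encode_instance I); lia.
- move=> [S fS]; exists (cover I); split=> //; first by have [] := cover_approx wf fS.
  by move=> S' /(cover_approx wf) [].
Qed.
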